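(* Let each $\mathsf{X}_i$, $i\in T$, be equipped with the trivial metric $\rho_i(x_i,z_i)=\mathbf{1}\{x_i\neq z_i\}$, and let $\mu$ be a Borel probability measure on $\mathsf{X}$. Define the upper-triangular matrix $\Gamma=(\Gamma_{ij})_{i,j\in T}$ by $$\Gamma_{ij}=\begin{cases}0,& i>j\\ 1,& i=j\\ \displaystyle\sup_{x,z\in\mathsf{X}:\ x^{T\setminus\{i\}}=z^{T\setminus\{i\}}}\left\|\mu^{[j,n]}(\cdot|x^{[i]})-\mu^{[j,n]}(\cdot|z^{[i]})\right\|_{\mathrm{TV}},& i<j.\end{cases}$$ Then, for any measurable $f:\mathsf{X}\to\mathbb{R}$ that is Lipschitz with respect to the Hamming metric $\rho(x,z)=\sum_{i\in T}\mathbf{1}\{x_i\ne z_i\}$ and for any $t\ge 0$, $$\mathbb{P}_\mu\Big\{|f(X)-\mathbb{E}_\mu[f(X)]|\ge t\Big\}\le 2\exp\left(-\frac{2t^2}{\|\Gamma\boldsymbol{\delta}(f)\|^2_{\ell^2(T)}}\right).$$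
   Context: Let $T=\{1,\dots,n\}$, $[i]=\{1,\dots,i\}$, $[j,n]=\{j,\dots,n\}$. For each $i\in T$, $\mathsf{X}_i$ is a Polish space with its Borel $\sigma$-field. For $I\subseteq T$, $\mathsf{X}^I=\prod_{i\in I}\mathsf{X}_i$ with the product $\sigma$-field, and $\mathsf{X}=\mathsf{X}^T$. $x^I$ denotes the restriction of $x$ to the coordinates in $I$. $X=(X_i)_{i\in T}$ is a random element of $\mathsf{X}$ with law $\mu$. The conditional laws $\mu^{[j,n]}(\cdot|x^{[i]})$, for $i<j$, are the laws of $X^{[j,n]}$ given $X^{[i]}=x^{[i]}$, obtained as marginals of a fixed version of the regular conditional law of $X^{\{i+1,\dots,n\}}$ given $X^{[i]}=x^{[i]}$. The total variation distance is $\|\eta-\eta'\|_{\mathrm{TV}}=\sup_A|\eta(A)-\eta'(A)|$ over Borel sets $A$. The local oscillation of a measurable $f:\mathsf{X}\to\mathbb{R}$ at $i$ is $$\delta_i(f)=\sup_{x,z\in\mathsf{X}:\ x^{T\setminus\{i\}}=z^{T\setminus\{i\}}}\frac{|f(x)-f(z)|}{\rho_i(x_i,z_i)},\qquad 0/0=0,$$ and $\boldsymbol{\delta}(f)=(\delta_i(f))_{i\in T}$. *)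

(* Defs.v *)
From HB Require Import structures.
From mathcomp Require Import all_boot all_order all_algebra.
From mathcomp Require Import all_classical all_reals all_analysis.

Set Implicit Arguments.
Unset Strict Implicit.
Unset Printing Implicit Defensive.

Import Order.TTheory GRing.Theory Num.Theory numFieldNormedType.Exports.

Local Open Scope classical_set_scope.
Local Open Scope ring_scope.

Section Polish.
Context (R : realType) (T : topologicalType).

Definition is_metric (d : T -> T -> R) : Prop :=
  [/\ forall x y, d x y = 0 <-> x = y,
      forall x y, d x y = d y x &
      forall x y z, d x z <= d x y + d y z].

Definition metrizes (d : T -> T -> R) : Prop :=
  forall (x : T) (A : set T),
    nbhs x A <-> exists2 e : R, 0 < e & [set y | d x y < e] `<=` A.

Definition complete_metric (d : T -> T -> R) : Prop :=
  forall u : nat -> T,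
    (forall e : R, 0 < e -> exists N : nat, forall p q : nat,
       (N <= p)%N -> (N <= q)%N -> d (u p) (u q) < e) ->
    exists l : T, u @ \oo --> l.

Definition polish : Prop :=
  (exists2 D : set T, countable D & dense D) /\
  exists d : T -> T -> R, [/\ is_metric d, metrizes d & complete_metric d].

End Polish.

Definition borel (T : topologicalType) : set (set T) := <<s @open T >>.
Arguments borel T : clear implicits.

(* Products are taken over an arbitrary index type J, so that the same space  *)
(* serves for X^T (J := 'I_n) and for X^I (J := {i | i \in I}).               *)
Section ProductSpace.
Context (J : Type) (Y : J -> ptopologicalType).

Definition coord_cylinders : set (set (forall j, Y j)) :=
  \bigcup_(j : J) preimage_set_system setT (fun x => x j) (borel (Y j)).

Definition prod_space : measurableType _ :=
  g_sigma_algebraType coord_cylinders.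

End ProductSpace.
Arguments coord_cylinders {J} Y.

Section Coordinates.
Context (n : nat) (X : 'I_n -> ptopologicalType).

Definition sub_space (I : {set 'I_n}) :=
  prod_space (fun j : {i | i \in I} => X (val j)).

(* x^I for x in the full product *)
Definition restr (I : {set 'I_n}) (x : prod_space X) : sub_space I :=
  fun j => x (val j).
Arguments restr I x : clear implicits.

(* x^J for x in X^I and J contained in I *)
Definition sub_restr (I J : {set 'I_n}) (sJI : J \subset I)
    (x : sub_space I) : sub_space J :=
  fun j => x (exist _ (val j) (fintype.subsetP sJI (val j) (valP j))).

(* Index blocks: [i], {i+1, ..., n} and [j, n].  Ordinals count from 0, which *)
(* does not affect these sets.                                                *)
Definition upto (i : 'I_n) : {set 'I_n} := [set k : 'I_n | (k <= i)%N]%SET.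
Definition after (i : 'I_n) : {set 'I_n} := [set k : 'I_n | (i < k)%N]%SET.
Definition from (j : 'I_n) : {set 'I_n} := [set k : 'I_n | (j <= k)%N]%SET.

Lemma from_sub_after (i j : 'I_n) : (i < j)%N -> from j \subset after i.
Proof.
move=> ij; apply/fintype.subsetP => k; rewrite !inE.
exact: leq_trans.
Qed.

Definition agree_off (i : 'I_n) (x z : prod_space X) : Prop :=
  restr (~: [set i])%SET x = restr (~: [set i])%SET z.

Definition trivial_metric (R : realType) (i : 'I_n) (a b : X i) : R :=
  (a != b)%:R.

Definition hamming (R : realType) (x z : prod_space X) : R :=
  \sum_(i < n) trivial_metric R (x i) (z i).

Definition hamming_lipschitz (R : realType) (f : prod_space X -> R) : Prop :=
  exists L : R, forall x z, `|f x - f z| <= L * hamming R x z.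

(* Division by 0 in R returns 0, in particular 0 / 0 = 0.                     *)
Definition local_osc (R : realType) (rho : forall i, X i -> X i -> R)
    (i : 'I_n) (f : prod_space X -> R) : \bar R :=
  ereal_sup [set r | exists x z : prod_space X, agree_off i x z /\
                       r = (`|f x - f z| / rho i (x i) (z i))%:E].

(* For Hamming-Lipschitz f every local oscillation with respect to the        *)
(* trivial metrics is finite, so that fine loses nothing.                     *)
Definition osc_vector (R : realType) (rho : forall i, X i -> X i -> R)
    (f : prod_space X -> R) : 'cV[R]_n :=
  \col_i fine (local_osc rho i f).

End Coordinates.

Arguments restr {n X} I x.
Arguments trivial_metric {n X} R i a b.

Definition tv_dist (R : realType) d (T : measurableType d)
    (eta eta' : set T -> \bar R) : \bar R :=
  ereal_sup [set `|eta A - eta' A|%E | A in measurable].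

(* k is a version of the regular conditional law of V given U under mu.       *)
Definition is_cond_law (R : realType) d d1 d2 (T : measurableType d)
    (T1 : measurableType d1) (T2 : measurableType d2) (mu : probability T R)
    (V : T -> T2) (U : T -> T1) (k : R.-pker T1 ~> T2) : Prop :=
  forall (A : set T1) (B : set T2), measurable A -> measurable B ->
    mu (U @^-1` A `&` V @^-1` B) = (\int[mu]_(x in U @^-1` A) k (U x) B)%E.

Section MixingMatrix.
Context (R : realType) (n : nat) (X : 'I_n -> ptopologicalType).

(* K i is the conditional law of the coordinates after i given those up to i. *)
Definition cond_laws := forall i : 'I_n,
  R.-pker (sub_space X (upto i)) ~> (sub_space X (after i)).

Definition is_cond_laws (mu : probability (prod_space X) R)
    (K : cond_laws) : Prop :=
  forall i, is_cond_law mu (restr (after i)) (restr (upto i)) (K i).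

(* mu^[j,n]( . | x^[i]) *)
Definition cond_marginal (K : cond_laws) (i j : 'I_n) (ij : (i < j)%N)
    (u : sub_space X (upto i)) : set (sub_space X (from j)) -> \bar R :=
  pushforward (K i u) (sub_restr (from_sub_after ij)).

(* The supremum is that of a nonempty set of numbers in [0, 1].               *)
Definition Gamma (K : cond_laws) : 'M[R]_n :=
  \matrix_(i, j)
    match @idP (i < j)%N with
    | ReflectT ij =>
        fine (ereal_sup [set r | exists x z : prod_space X, agree_off i x z /\
          r = tv_dist (cond_marginal K ij (restr (upto i) x))
                      (cond_marginal K ij (restr (upto i) z))])
    | ReflectF _ => if i == j then 1 else 0
    end.

End MixingMatrix.

Definition l2norm (R : realType) (n : nat) (v : 'cV[R]_n) : R :=
  Num.sqrt (\sum_(i < n) v i ord0 ^+ 2).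

(* Main.v *)
Require Import Defs.
From HB Require Import structures.
From mathcomp Require Import all_boot all_order all_algebra.
From mathcomp Require Import all_classical all_reals all_analysis.
From mathcomp Require Import measurable_realfun ring lra.

Set Implicit Arguments.
Unset Strict Implicit.
Unset Printing Implicit Defensive.

Import Order.TTheory GRing.Theory Num.Theory numFieldNormedType.Exports.

Local Open Scope classical_set_scope.
Local Open Scope ring_scope.

(** Put [F_i := E(f | X^[i])], computed with the given kernels.  For a fixed past
    the conditional law of the next coordinate makes [F_(i+1)] vary by at most the
    oscillation of [F_(i+1)] in its last coordinate, so Hoeffding's lemma, applied
    kernel by kernel, multiplies the exponential moment by at most
    [exp (s^2 c^2 / 8)].  It remains to see that this oscillation is at most
    [(Gamma delta)_i].

    This is a bound on [int f dP - int f dQ] by [sum_j b_j tau_j], where [f]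
    oscillates by at most [b_j] in the coordinate [j] and [P], [Q] differ by at most
    [tau_j] on the events depending on the coordinates from [j] on.  If [G_j] is the
    infimum of [f] over the coordinates before [j], then [0 <= G_j - G_(j+1) <= b_j]
    and [f - G_n] telescopes into functions of the coordinates from [j] on, to which
    the layer-cake formula applies; no coupling is needed.  Infima over uncountable
    sets need not be measurable, so [f] is first replaced by
    [y |-> inf_w (f w + sum_j b_j 1{w_j <> y_j})], with [f] rounded to finitely many
    values and [w] ranging over a compact set for each value: then everything is
    expressed with projections of compact sets.  The compact sets come from the
    inner regularity of [Q], and this is where the spaces have to be Polish. *)

(** * Complete separable metrics *)

Section MetrizedSpace.
Context (R : realType) (T : topologicalType) (d : T -> T -> R).
Hypotheses (metric_d : is_metric d) (metrizes_d : metrizes d).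

Let dxx x : d x x = 0. Proof. by case: metric_d => h _ _; apply/h. Qed.

Let dC x y : d x y = d y x. Proof. by case: metric_d. Qed.

Let d_triangle x y z : d x z <= d x y + d y z.
Proof. by case: metric_d. Qed.

Lemma metric_ge0 x y : 0 <= d x y.
Proof. have := d_triangle x y x; rewrite dxx (dC y x); lra. Qed.

Lemma nbhs_metric_ball x e : 0 < e -> nbhs x [set y | d x y < e].
Proof. by move=> e0; apply/metrizes_d; exists e. Qed.

Lemma open_metric_gt y e : open [set x | e < d x y].
Proof.
rewrite openE => x /= exy; apply/metrizes_d; exists (d x y - e).
  by rewrite subr_gt0.
by move=> z /= dxz; have := d_triangle x z y; lra.
Qed.

Lemma open_metric_ball y e : open [set x | d x y < e].
Proof.
rewrite openE => x /= exy; apply/metrizes_d; exists (e - d x y).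
  by rewrite subr_gt0.
by move=> z /= dxz; have := d_triangle z x y; rewrite (dC z x); lra.
Qed.

Lemma closed_metric_ball y e : closed [set x | d x y <= e].
Proof.
rewrite -openC (_ : ~` _ = [set x | e < d x y]); first exact: open_metric_gt.
by apply/seteqP; split => x /=; rewrite ltNge => /negP.
Qed.

(** [F m] collects the points at distance at least 1/(m+1) from the complement of [O]. Through this
    the inner regularity of closed cylinders passes to open ones. *)
Lemma open_bigcup_closed (O : set T) : open O ->
  exists F : nat -> set T, (forall m, closed (F m)) /\ O = \bigcup_m F m.
Proof.
move=> oO.
pose F m := [set x | forall y, d x y < m.+1%:R^-1 -> O y].
exists F; split.
  move=> m; rewrite -openC openE => x /= /existsNP[y /not_implyP[dxy nOy]].
  have : nbhs x [set z | d z y < m.+1%:R^-1].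
    by apply: open_nbhs_nbhs; split => //; exact: open_metric_ball.
  by apply: filterS => z /= dzy /(_ y dzy).
apply/seteqP; split=> [x Ox|x [m _ /(_ x)]]; last first.
  by rewrite dxx; apply; rewrite invr_gt0.
have /metrizes_d [e e0 eO] := open_nbhs_nbhs (conj oO Ox).
exists (Num.truncn e^-1) => // y /= dxy; apply: eO => /=.
apply: (lt_trans dxy); rewrite -[ltRHS]invrK ltf_pV2 ?posrE ?invr_gt0//.
exact: truncnS_gt.
Qed.

(* Every ultrafilter on a closed totally bounded set is Cauchy. *)
Lemma totally_bounded_compact (c : nat -> T) (N : nat -> nat) :
  complete_metric d ->
  compact (\bigcap_m \bigcup_(k in `I_(N m)) [set x | d x (c k) <= m.+1%:R^-1]).
Proof.
move=> complete_d; set C := (X in compact X).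
rewrite compact_ultra => F UF FC.
have PF : ProperFilter F := ultra_proper.
(* An ultrafilter that contains a finite union contains one of its members: at every radius it
   selects a single ball. *)
have Fball m : exists k, F [set x | d x (c k) <= m.+1%:R^-1].
  have : F (\bigcup_(k in `I_(N m)) [set x | d x (c k) <= m.+1%:R^-1]).
    by apply: filterS FC => x /(_ m I).
  elim: (N m) => [|n IHn].
    by rewrite II0 bigcup_set0 => /filter_ex [].
  have [Fn _|nFn] := in_ultra_setVsetC [set x | d x (c n) <= m.+1%:R^-1] UF.
    by exists n.
  move=> Fb; apply: IHn; apply: filterS (filterI Fb nFn) => x /= [[k /=]].
  rewrite ltnS leq_eqVlt => /orP[/eqP ->//|kn dk _].
  by exists k.
have [k Fk] := choice Fball.
(* Points [p m] chosen in the first [m.+1] selected balls form a Cauchy sequence, whose limit will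
   be the limit of the ultrafilter. *)
pose I_ m := \bigcap_(l in `I_m.+1) [set x | d x (c (k l)) <= l.+1%:R^-1].
have FI m : F (I_ m).
  rewrite /I_; elim: m => [|m IHm].
    by apply: filterS (Fk 0%N) => x hx [|//].
  apply: filterS (filterI (Fk m.+1) IHm) => x [hx hm] l /=.
  by rewrite ltnS leq_eqVlt => /orP[/eqP ->//|/hm].
have [p pI] := choice (fun m => filter_ex (FI m)).
have dp l m : (l <= m)%N -> d (p m) (c (k l)) <= l.+1%:R^-1.
  by move=> lm; apply: (pI m); rewrite /= ltnS.
have small e : 0 < e :> R -> exists n : nat, n.+1%:R^-1 < e.
  move=> e0; exists (Num.truncn e^-1).
  rewrite -[ltRHS]invrK ltf_pV2 ?posrE ?invr_gt0//.
  exact: truncnS_gt.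
have [l pl] : exists l : T, p @ \oo --> l.
  apply: complete_d => e e0; have [n ne] := small (e / 2) ltac:(lra).
  exists n => q r nq nr.
  have := d_triangle (p q) (c (k n)) (p r).
  have := dp _ _ nq; have := dp _ _ nr; move: ne.
  rewrite (dC (c (k n))); set a := _^-1; lra.
(* The [n]-th selected ball lies within [e] of [l]: from [l] to [p (maxn m n)], from there to the
   centre [c (k n)], from there to [x], each leg below e/3. *)
have Fl : F --> l.
  move=> A /metrizes_d[e e0 eA].
  have [n ne] := small (e / 3) ltac:(lra).
  apply: filterS (Fk n) => x /= dx; apply: eA => /=.
  have e3 : 0 < e / 3 by rewrite divr_gt0.
  have [m _ hm] := pl _ (nbhs_metric_ball l e3).
  have dl : d l (p (maxn m n)) < e / 3 by apply: hm; rewrite /= leq_maxl.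
  have := dp _ _ (leq_maxr m n).
  have := d_triangle l (p (maxn m n)) x.
  have := d_triangle (p (maxn m n)) (c (k n)) x.
  move: ne dx dl; rewrite (dC (c (k n)) x); set a := _^-1; lra.
exists l; split => //.
suff : closed C.
  apply => A /Fl FA; exact: (filter_ex (filterI FC FA)).
apply: closed_bigI => m _; apply: closed_bigcup => //.
by move=> j _; exact: closed_metric_ball.
Qed.

End MetrizedSpace.

Lemma probability_bigcap0_le (R : realType) d (T : measurableType d)
    (P : probability T R) (F : nat -> set T) (e : R) :
  (forall m, measurable (F m)) -> nonincreasing_seq F ->
  \bigcap_m F m = set0 -> 0 < e -> exists m, (P (F m) <= e%:E)%E.
Proof.
move=> mF ndF F0 e0.
have : P \o F @ \oo --> 0%E.
  rewrite -(measure0 P) -F0; apply: nonincreasing_cvg_mu => //.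
    by rewrite (le_lt_trans (probability_le1 _ _)) ?ltry.
  exact: bigcapT_measurable.
move=> /fine_cvgP[_ /cvgrPdist_lt /(_ _ e0) [n _ /(_ n (leqnn n))]] /=.
rewrite sub0r normrN => /(le_lt_trans (ler_norm _)) Pe; exists n.
by rewrite -(fineK (fin_num_measure P _ (mF n))) lee_fin ltW.
Qed.

Lemma polish_dense_sequence (R : realType) (T : ptopologicalType) :
  polish R T -> exists (d : T -> T -> R) (c : nat -> T),
    [/\ is_metric d, metrizes d, complete_metric d &
        forall x e, 0 < e -> exists k, d x (c k) < e].
Proof.
move=> [[D cD dD] [d [md mtd cmd]]].
have [c cE] : exists c : nat -> T, D `<=` range c.
  case/pfcard_geP : cD => [D0|[c]]; last by exists c; exact: surj.
  by exists (fun=> point); rewrite D0.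
exists d, c; split => // x e e0.
have [y [/= dxy /cE[k _ cky]]] : [set y | d x y < e] `&` D !=set0.
  apply: dD; first by exists x => /=; case: (md) => dxx _ _; rewrite (dxx _ _).2.
  rewrite (_ : mkset _ = [set y | d y x < e]).
    exact: (open_metric_ball md mtd).
  by case: (md) => _ dC _; apply/seteqP; split=> z /=; rewrite dC.
by exists k; rewrite cky.
Qed.

(** * Tightness of a single law *)

Section Tightness.
Context (R : realType) (T : ptopologicalType).
Variables (d : T -> T -> R) (c : nat -> T).
Hypotheses (md : is_metric d) (mtd : metrizes d) (cmd : complete_metric d).
Hypothesis dense_c : forall x e, 0 < e -> exists k, d x (c k) < e.
Context d0 (Om : measurableType d0) (P : probability Om R) (g : Om -> T).
Hypothesis mg : forall C, closed C -> measurable (g @^-1` C).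

(** Ulam's theorem. At radius 1/(m+1), finitely many balls around the dense sequence carry all but
    e/2^(m+1) of the mass, and the intersection over [m] is closed and totally bounded. The law is
    given as the image of [P] under [g], so that [T] carries only its topology. *)
Lemma complete_separable_tight (e : R) : 0 < e ->
  exists C : set T, [/\ compact C, closed C & (P (g @^-1` ~` C) <= e%:E)%E].
Proof.
move=> e0.
pose B m n := g @^-1` ~` \bigcup_(k in `I_n) [set x | d x (c k) <= m.+1%:R^-1].
have closedB m n : closed (\bigcup_(k in `I_n) [set x | d x (c k) <= m.+1%:R^-1]).
  apply: closed_bigcup => // k _; exact: (closed_metric_ball md mtd).
have mB m n : measurable (B m n).
  by rewrite /B preimage_setC; apply: measurableC; exact: mg (closedB m n).
have /choice[N PN] : forall m, exists n, (P (B m n) <= (e / (2 ^ m.+1)%:R)%:E)%E.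
  move=> m.
  have B0 : \bigcap_n B m n = set0.
    apply/seteqP; split => // x Bx.
    have [k dk] := dense_c (g x) (e := m.+1%:R^-1) ltac:(by rewrite invr_gt0).
    by have := Bx k.+1 I; apply; exists k => //=; rewrite ltW.
  apply: probability_bigcap0_le => //; last by rewrite divr_gt0.
  move=> n1 n2 n12; apply/subsetPset => x /= Bx [k kn hk]; apply: Bx.
  by exists k => //=; exact: leq_trans n12.
exists (\bigcap_m \bigcup_(k in `I_(N m)) [set x | d x (c k) <= m.+1%:R^-1]).
split.
- exact: totally_bounded_compact.
- by apply: closed_bigI => m _; exact: closedB.
- rewrite setC_bigcap preimage_bigcup.
  apply: le_trans (epsilon_trick0 xpredT (ltW e0)).
  apply: le_trans (lee_nneseries _ (fun m _ => PN m)) => //.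
  apply: measure_sigma_subadditive => //.
  by apply: bigcupT_measurable => m; exact: mB.
Qed.

End Tightness.

(** * Inner regularity by compact sets *)

Lemma measurable_coord_preimage (J : Type) (Y : J -> ptopologicalType) (j : J)
    (B : set (Y j)) :
  borel (Y j) B -> measurable ((fun x : prod_space Y => x j) @^-1` B).
Proof.
by move=> bB; apply: sub_sigma_algebra; exists j => //; exists B; rewrite ?setTI.
Qed.

Lemma borel_open (T : topologicalType) (O : set T) : open O -> borel T O.
Proof. exact: sub_sigma_algebra. Qed.

Lemma borel_closed (T : topologicalType) (C : set T) : closed C -> borel T C.
Proof.
move=> cC; rewrite -(setCK C) -setTD.
by apply: sigma_algebraCD; apply: borel_open; exact: closed_openC.
Qed.

(** The cylinder over the projection of [K] to the coordinates in [S]. For a compact [K] it is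
    measurable, whereas projections of general Borel sets need not be. *)
Definition saturation (J : Type) (Y : J -> Type) (S : set J)
    (K : set (forall j, Y j)) : set (forall j, Y j) :=
  [set y | exists2 w, K w & forall j, S j -> w j = y j].

Section InnerRegularity.
Context (R : realType) (n : nat) (X : 'I_n -> ptopologicalType).
Variables (d : forall i, X i -> X i -> R) (c : forall i, nat -> X i).
Arguments d : clear implicits.
Arguments c : clear implicits.
Hypotheses (md : forall i, is_metric (d i)) (mtd : forall i, metrizes (d i)).
Hypothesis (cmd : forall i, complete_metric (d i)).
Hypothesis dense_c : forall i x e, 0 < e -> exists k, d i x (c i k) < e.
Arguments md : clear implicits.
Arguments mtd : clear implicits.
Arguments cmd : clear implicits.
Arguments dense_c : clear implicits.

Let cpt (K : set (forall i, X i)) :=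
  compact (K : set (prod_topology X)) /\ closed (K : set (prod_topology X)).

Let open_coord i (O : set (X i)) : open O ->
  open ((fun x : prod_topology X => x i) @^-1` O).
Proof.
by move=> oO; move: i O oO => i; apply/continuousP; exact: proj_continuous.
Qed.

Let closed_coord i (C : set (X i)) : closed C ->
  closed ((fun x : prod_topology X => x i) @^-1` C).
Proof.
move=> /closed_openC/open_coord; rewrite preimage_setC => /open_closedC.
by rewrite setCK.
Qed.

Let d_ge0 i x y : 0 <= d i x y. Proof. exact: metric_ge0. Qed.

Let d_eq0 i x y : d i x y = 0 -> x = y.
Proof. by case: (md i) => h _ _ /h. Qed.

Let dC i x y : d i x y = d i y x. Proof. by case: (md i). Qed.

Let d_triangle i x y z : d i x z <= d i x y + d i y z.
Proof. by case: (md i). Qed.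

(** A point off the projection of a compact set keeps a positive distance from it. Otherwise some
    sequence in [K] would approach [y] on [S], and a cluster point of it would lie in [K] and agree
    with [y] on [S]. *)
Lemma saturation_compact_far (K : set (forall i, X i)) S y :
  compact (K : set (prod_topology X)) -> ~ saturation S K y ->
  exists m : nat, forall w, K w -> exists2 k, S k & m.+1%:R^-1 < d k (w k) (y k).
Proof.
move=> cK ySK; apply: contrapT => /forallNP H.
have {}H m : exists w, K w /\ forall k, S k -> d k (w k) (y k) <= m.+1%:R^-1.
  have /existsNP[w /not_implyP[Kw Hw]] := H m; exists w; split=> // k Sk.
  by rewrite leNgt; apply/negP => lt; apply: Hw; exists k.
have /choice[w wP] := H.
have [p [Kp Cp]] := cK ((w : nat -> prod_topology X) @ \oo) _
  (@filterE _ \oo _ _ (fun m => (wP m).1)).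
apply: ySK; exists p => // k Sk; apply: d_eq0; apply/eqP.
rewrite eq_le d_ge0 andbT leNgt; apply/negP => dk0.
set e := d k (p k) (y k) in dk0.
pose M := Num.truncn (e / 2)^-1.
have e20 : 0 < e / 2 by rewrite divr_gt0.
have Me : M.+1%:R^-1 < e / 2.
  rewrite -[ltRHS]invrK ltf_pV2 ?posrE ?invr_gt0//; exact: truncnS_gt.
have : (w @ \oo) [set v | d k (v k) (y k) < e / 2].
  exists M => // m /= Mm; apply: le_lt_trans ((wP m).2 k Sk) (le_lt_trans _ Me).
  by rewrite lef_pV2 ?posrE// ler_nat.
move=> /Cp Cpw.
have [|v [/= /ltW]] := Cpw [set v : forall i, X i | e / 2 < d k (v k) (y k)].
  apply: open_nbhs_nbhs; split; last by rewrite /= -/e; lra.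
  apply: (open_coord (O := [set z | e / 2 < d k z (y k)])).
  exact: (open_metric_gt (md k) (mtd k)).
by rewrite leNgt => /negP.
Qed.

(** The complement is the union of the boxes disjoint from the saturation, among countably many
    boxes with centres in the dense sequences and radii 1/(r+1). *)
Lemma measurable_saturation (K : set (forall i, X i)) (S : set 'I_n) :
  compact (K : set (prod_topology X)) ->
  measurable (saturation S K : set (prod_space X)).
Proof.
move=> cK.
pose box (q : {ffun 'I_n -> nat} * nat) : set (prod_space X) :=
  \bigcap_(k in S) [set y | d k (y k) (c k (q.1 k)) < q.2.+1%:R^-1].
have mbox q : measurable (box q).
  apply: fin_bigcap_measurable => // k _.
  apply: (measurable_coord_preimage
    (B := [set z | d k z (c k (q.1 k)) < q.2.+1%:R^-1])).
  apply: borel_open; exact: (open_metric_ball (md k) (mtd k)).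
have -> : saturation S K =
    ~` \bigcup_(q in [set q | box q `&` saturation S K = set0]) box q.
  rewrite setC_bigcup; apply/seteqP; split => [y Sy q /= q0 qy|y Hy].
    by have : (box q `&` saturation S K) y by []; rewrite q0.
  apply: contrapT => /(saturation_compact_far cK)[m Hm].
  (* The radius 1/(2m+2) is half of the distance 1/(m+1) that separates [y] from [K], so a box of
     that radius around a centre that close to [y] misses the saturation. *)
  have /choice[f fP] : forall k, exists l, d k (y k) (c k l) < (m.*2.+1).+1%:R^-1.
    by move=> k; apply: dense_c; rewrite invr_gt0.
  have boxy : box ([ffun k => f k], m.*2.+1) y.
    by move=> k Sk /=; rewrite ffunE.
  apply: (Hy ([ffun k => f k], m.*2.+1)) => //=.
  apply/seteqP; split => // z [bz [w Kw wz]].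
  have [k Sk] := Hm w Kw; rewrite wz//; apply/negP; rewrite -leNgt.
  have := bz k Sk; rewrite /= ffunE => h1.
  have := d_triangle (z k) (c k (f k)) (y k); rewrite (dC (c k (f k)) (y k)).
  have := fP k; move: h1.
  rewrite (_ : m.*2.+2%:R^-1 = m.+1%:R^-1 / 2 :> R); first by set a := _^-1; lra.
  by rewrite -invfM -natrM muln2.
apply: measurableC; rewrite bigcup_mkcond.
apply: countable_bigcupT_measurable; first exact: countableP.
by move=> q; case: ifPn.
Qed.


Lemma measurable_compact (K : set (forall i, X i)) :
  compact (K : set (prod_topology X)) -> measurable (K : set (prod_space X)).
Proof.
move=> cK; have := measurable_saturation setT cK.
congr (measurable _); apply/seteqP; split => [x [w Kw wx]|x Kx].
  by rewrite (_ : x = w)//; apply: functional_extensionality_dep => i; rewrite wx.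
by exists x.
Qed.

Variable P : probability (prod_space X) R.

Let inner (A : set (prod_space X)) := forall e, 0 < e ->
  exists K, [/\ cpt K, K `<=` A & (P (A `\` K) <= e%:E)%E].

(** One half of [e] pays for approximating all the [A m] by compact sets, the other half for cutting
    the union of these down to a finite one, which is again compact. *)
Let inner_bigcup (A : nat -> set (prod_space X)) :
  (forall m, measurable (A m)) -> (forall m, inner (A m)) ->
  inner (\bigcup_m A m).
Proof.
move=> mA iA e e0.
have e2 : 0 < e / 2 by rewrite divr_gt0.
have /choice[K KP] : forall m, exists K, [/\ cpt K, K `<=` A m &
    (P (A m `\` K) <= (e / 2 / (2 ^ m.+1)%:R)%:E)%E].
  by move=> m; apply: iA; rewrite divr_gt0.
have mK m : measurable (K m : set (prod_space X)).
  by apply: measurable_compact; have [[]] := KP m.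
pose U N := \bigcup_(m in `I_N) K m.
have mU N : measurable (U N : set (prod_space X)).
  exact: bigcup_measurable.
have mKK : measurable (\bigcup_m K m : set (prod_space X)).
  exact: bigcup_measurable.
have [N PN] : exists N, (P ((\bigcup_m K m) `\` U N) <= (e / 2)%:E)%E.
  apply: probability_bigcap0_le => //.
  - by move=> m; apply: measurableD.
  - move=> k l kl; apply/subsetPset => x [Kx Ux]; split => // -[m mk Kmx].
    by apply: Ux; exists m => //=; exact: leq_trans kl.
  - apply/seteqP; split => // x H; have [[m _ Kmx] _] := H 0%N I.
    by have [_ NU] := H m.+1 I; apply: NU; exists m => /=.
exists (U N); split.
- split.
    rewrite /U bigcup_mkord; apply: bigsetU_compact => m _.
    by have [[]] := KP m.
  by apply: closed_bigcup => // m _; have [[]] := KP m.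
- by move=> x [m _ Kx]; exists m => //; have [_ KA _] := KP m; exact: KA.
- have mAK : measurable (\bigcup_m (A m `\` K m) : set (prod_space X)).
    by apply: bigcupT_measurable => m; exact: measurableD.
  apply: (@le_trans _ _ (P (\bigcup_m (A m `\` K m) `|`
      ((\bigcup_m K m) `\` U N)))).
    apply: le_measure; rewrite ?inE.
    + by apply: measurableD => //; exact: bigcupT_measurable.
    + by apply: measurableU => //; exact: measurableD.
    + move=> x [[m _ Ax] Ux]; have [Kx|Kx] := pselect ((\bigcup_m K m) x).
        by right.
      by left; exists m => //; split => // Kmx; apply: Kx; exists m.
  apply: le_trans (measureU2 _ _ _) _ => //; first exact: measurableD.
  rewrite (splitr e) EFinD; apply: leeD => //.
  apply: le_trans (epsilon_trick0 xpredT (ltW e2)).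
  apply: (@le_trans _ _ (\sum_(m <oo) P (A m `\` K m))%E).
    apply: measure_sigma_subadditive => //.
    by move=> m; exact: measurableD.
  by apply: lee_nneseries => // m _; have [] := KP m.
Qed.

Let inner_bigcap (A : nat -> set (prod_space X)) :
  (forall m, measurable (A m)) -> (forall m, inner (A m)) ->
  inner (\bigcap_m A m).
Proof.
move=> mA iA e e0.
have /choice[K KP] : forall m, exists K, [/\ cpt K, K `<=` A m &
    (P (A m `\` K) <= (e / (2 ^ m.+1)%:R)%:E)%E].
  by move=> m; apply: iA; rewrite divr_gt0.
have mK m : measurable (K m : set (prod_space X)).
  by apply: measurable_compact; have [[]] := KP m.
exists (\bigcap_m K m).
have cK : closed (\bigcap_m K m : set (prod_topology X)).
  by apply: closed_bigI => m _; have [[]] := KP m.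
split.
- split => //.
  apply: (@subclosed_compact _ _ (K 0%N : set (prod_topology X)) cK); last first.
    by move=> x Kx; exact: Kx.
  by have [[]] := KP 0%N.
- by move=> x Kx m _; have [_ KA _] := KP m; apply: KA; exact: Kx.
apply: le_trans (epsilon_trick0 xpredT (ltW e0)).
apply: (@le_trans _ _ (\sum_(m <oo) P (A m `\` K m))%E).
  apply: measure_sigma_subadditive => //.
  - by move=> m; exact: measurableD.
  - by apply: measurableD; exact: bigcapT_measurable.
  - move=> x [Ax /existsNP[m /not_implyP[_ Kmx]]]; exists m => //.
    by split => //; exact: Ax.
by apply: lee_nneseries => // m _; have [] := KP m.
Qed.

(** Each coordinate has a tight law; by Tychonoff the product of the compact sets obtained is
    compact, and so is its trace on [C]. *)
Let inner_closed (C : set (prod_space X)) : measurable C ->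
  closed (C : set (prod_topology X)) -> inner C.
Proof.
move=> mC cC e e0.
have H j : exists B : set (X j), [/\ compact B, closed B &
    (P ((fun x : prod_space X => x j) @^-1` ~` B) <= (e / (2 ^ j.+1)%:R)%:E)%E].
  apply: (complete_separable_tight (md j) (mtd j) (cmd j) (dense_c j)); last first.
    by rewrite divr_gt0.
  move=> D cD; by apply: measurable_coord_preimage; exact: borel_closed.
pose B j := sval (cid (H j)).
have BP j : [/\ compact (B j), closed (B j) &
    (P ((fun x : prod_space X => x j) @^-1` ~` B j) <= (e / (2 ^ j.+1)%:R)%:E)%E].
  by rewrite /B; case: cid.
pose Q : set (forall i, X i) := [set x | forall j, B j (x j)].
have cQ : compact (Q : set (prod_topology X)).
  by apply: tychonoff => j; have [] := BP j.
have clQ : closed (Q : set (prod_topology X)).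
  have -> : Q = \bigcap_j [set x | B j (x j)].
    by apply/seteqP; split => x Qx j; [move=> _|]; exact: Qx.
  by apply: closed_bigI => j _; apply: closed_coord; have [] := BP j.
exists (C `&` Q); split.
- split; last exact: closedI.
  by apply: subclosed_compact cQ (@subIsetr _ _ _); exact: closedI.
- exact: subIsetl.
(* The finitely many exceptional events are continued by empty sets to a sequence, to which
   countable subadditivity and the errors e/2^(m+1) apply. *)
pose F m : set (prod_space X) := if insub m is Some j then
  (fun x : prod_space X => x j) @^-1` ~` B j else set0.
have mF m : measurable (F m).
  rewrite /F; case: insubP => // j _ _; apply: measurable_coord_preimage.
  by apply: borel_open; apply: closed_openC; have [] := BP j.
apply: le_trans (epsilon_trick0 xpredT (ltW e0)).
apply: (@le_trans _ _ (\sum_(m <oo) P (F m))%E).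
  apply: measure_sigma_subadditive => //.
  - apply: measurableD => //; apply: measurableI => //.
    exact: measurable_compact.
  - move=> x [Cx CQx]; have /existsNP[j Bj] : ~ Q x by move=> Qx; apply: CQx.
    by exists j => //; rewrite /F valK.
apply: lee_nneseries => // m _.
rewrite /F; case: insubP => [j _ <-|_]; first by have [] := BP j.
by rewrite measure0 lee_fin divr_ge0// ltW.
Qed.

(** Approximability of the complement is included to obtain stability under complements; countable
    unions then call for both [inner_bigcup] and [inner_bigcap]. *)
Let good (A : set (prod_space X)) := [/\ measurable A, inner A & inner (~` A)].

Let good_sigma_algebra : sigma_algebra setT good.
Proof.
split.
- split => //; last first.
    by rewrite setC0; apply: inner_closed => //; exact: closedT.
  move=> e e0; exists set0; split => //; first by split; [exact: compact0|exact: closed0].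
  by rewrite setD0 measure0 lee_fin ltW.
- by move=> A [mA iA iCA]; rewrite setTD; split; rewrite ?setCK//; exact: measurableC.
- move=> A gA; split.
  + by apply: bigcupT_measurable => m; have [] := gA m.
  + by apply: inner_bigcup => m; have [] := gA m.
  + rewrite setC_bigcup; apply: inner_bigcap => m; have [mA _ //] := gA m.
    by move=> ?; exact: measurableC.
Qed.

(** The good sets form a sigma-algebra, so open cylinders over one coordinate suffice. Such a
    cylinder is a countable union of closed ones, and its complement is closed. *)
Lemma inner_regular (A : set (prod_space X)) (e : R) : measurable A -> 0 < e ->
  exists K : set (forall i, X i), [/\ compact (K : set (prod_topology X)),
    K `<=` A & (P (A `\` K) <= e%:E)%E].
Proof.
move=> mA e0.
suff : good A by move=> [_ iA _]; have [K [[cK _] KA PK]] := iA e e0; exists K.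
move: A mA; apply: smallest_sub; first exact: good_sigma_algebra.
move=> _ [j _ [B bB <-]]; rewrite setTI; move: B bB.
have sj : sigma_algebra setT [set B : set (X j) | good (@^~ j @^-1` B)].
  have [g0 gC gU] := good_sigma_algebra; split.
  - by rewrite /= preimage_set0.
  - by move=> B gB; rewrite /= setTD preimage_setC -setTD; exact: gC.
  - by move=> F gF; rewrite /= preimage_bigcup; exact: gU.
apply: (smallest_sub sj) => O oO; split.
- by apply: measurable_coord_preimage; exact: borel_open.
- have [F [cF ->]] := open_bigcup_closed (md j) (mtd j) oO.
  rewrite preimage_bigcup; apply: inner_bigcup.
    by move=> m; apply: measurable_coord_preimage; exact: borel_closed.
  move=> m; apply: inner_closed; last exact: closed_coord.
  by apply: measurable_coord_preimage; exact: borel_closed.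
- rewrite preimage_setC; apply: inner_closed.
    by apply: measurable_coord_preimage; apply: borel_closed; exact: open_closedC.
  by apply: closed_coord; exact: open_closedC.
Qed.

End InnerRegularity.

(** Metrics and dense sequences disappear here, and of compactness only the measurability of all
    saturations is kept. *)
Lemma polish_inner_regular (R : realType) (n : nat) (X : 'I_n -> ptopologicalType)
    (polishX : forall i, polish R (X i)) (P : probability (prod_space X) R)
    (A : set (prod_space X)) (e : R) : measurable A -> 0 < e ->
  exists K : set (forall i, X i),
    [/\ K `<=` A, (P (A `\` K) <= e%:E)%E &
        forall S, measurable (saturation S K : set (prod_space X))].
Proof.
move=> mA e0.
have H i : exists dc : (X i -> X i -> R) * (nat -> X i),
    [/\ is_metric dc.1, metrizes dc.1, complete_metric dc.1 &
        forall x e, 0 < e -> exists k, dc.1 x (dc.2 k) < e].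
  by have [d [c dcP]] := polish_dense_sequence (polishX i); exists (d, c).
pose dc i := sval (cid (H i)).
have dcP i := svalP (cid (H i)).
have md i : is_metric (dc i).1 by have [] := dcP i.
have mtd i : metrizes (dc i).1 by have [] := dcP i.
have cmd i : complete_metric (dc i).1 by have [] := dcP i.
have dense_c i x (e' : R) : 0 < e' -> exists k, (dc i).1 x ((dc i).2 k) < e'.
  by have [_ _ _] := dcP i; apply.
have [K [cK KA PK]] := inner_regular md mtd cmd dense_c P mA e0.
by exists K; split => // S; exact: (measurable_saturation md mtd dense_c).
Qed.

(** * Integrals of bounded measurable functions *)

Section BoundedMeasurable.
Context (R : realType) d (T : measurableType d).
Implicit Types (g h : T -> R) (P : probability T R).

(** A class stable under the operations below and integrable for every probability, which spares
    separate integrability arguments. *)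
Definition bounded_mfun g :=
  measurable_fun setT g /\ exists M, forall x, `|g x| <= M.

Lemma bounded_mfun_cst r : bounded_mfun (fun=> r).
Proof. by split; [exact: measurable_cst|exists `|r|]. Qed.

Lemma bounded_mfunD g h :
  bounded_mfun g -> bounded_mfun h -> bounded_mfun (fun x => g x + h x).
Proof.
move=> [mg [M gM]] [mh [N hN]]; split; first exact: measurable_funD.
by exists (M + N) => x; apply: le_trans (ler_normD _ _) _; exact: lerD.
Qed.

Lemma bounded_mfunM g h :
  bounded_mfun g -> bounded_mfun h -> bounded_mfun (fun x => g x * h x).
Proof.
move=> [mg [M gM]] [mh [N hN]]; split; first exact: measurable_funM.
by exists (M * N) => x; rewrite normrM; exact: ler_pM.
Qed.

Lemma bounded_mfunN g : bounded_mfun g -> bounded_mfun (fun x => - g x).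
Proof.
move=> [mg [M gM]]; split; first exact: measurableT_comp.
by exists M => x; rewrite normrN.
Qed.

Lemma bounded_mfunB g h :
  bounded_mfun g -> bounded_mfun h -> bounded_mfun (fun x => g x - h x).
Proof. by move=> bg bh; apply: bounded_mfunD => //; exact: bounded_mfunN. Qed.

Lemma bounded_mfun_indic (A : set T) : measurable A -> bounded_mfun (\1_A : T -> R).
Proof.
move=> mA; split; first exact: measurable_indic.
by exists 1 => x; rewrite indicE; case: (_ \in _); rewrite ?normr1 ?normr0.
Qed.

Lemma bounded_mfun_min g h : bounded_mfun g -> bounded_mfun h ->
  bounded_mfun (fun x => Num.min (g x) (h x)).
Proof.
move=> [mg [M gM]] [mh [N hN]]; split; first exact: measurable_minr.
exists (Num.max M N) => x; rewrite le_max /Num.min; case: ifP => _.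
  by rewrite gM.
by rewrite hN orbT.
Qed.

Lemma bounded_mfun_expR g : bounded_mfun g -> bounded_mfun (fun x => expR (g x)).
Proof.
move=> [mg [M gM]]; split; first exact: measurableT_comp.
exists (expR M) => x; rewrite ger0_norm ?expR_ge0// ler_expR.
exact: le_trans (ler_norm _) (gM x).
Qed.

Lemma bounded_mfun_sum (I : Type) (r : seq I) (F : I -> T -> R) :
  (forall i, bounded_mfun (F i)) -> bounded_mfun (fun x => \sum_(i <- r) F i x).
Proof.
move=> bF; elim: r => [|i r IHr].
  by under eq_fun do rewrite big_nil; exact: bounded_mfun_cst.
by under eq_fun do rewrite big_cons; exact: bounded_mfunD.
Qed.

Lemma bounded_mfun_bigmin (I : Type) (r : seq I) (b : R) (F : I -> T -> R) :
  (forall i, bounded_mfun (F i)) ->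
  bounded_mfun (fun x => \big[Num.min/b]_(i <- r) F i x).
Proof.
move=> bF; elim: r => [|i r IHr].
  by under eq_fun do rewrite big_nil; exact: bounded_mfun_cst.
by under eq_fun do rewrite big_cons; exact: bounded_mfun_min.
Qed.

Variable P : probability T R.

Lemma bounded_mfun_integrable g : bounded_mfun g -> P.-integrable setT (EFin \o g).
Proof.
move=> [mg [M gM]]; apply: measurable_bounded_integrable => //.
  by rewrite (le_lt_trans (probability_le1 _ _)) ?ltry.
exists M; split; first exact: num_real.
by move=> N MN x _; apply: le_trans (gM x) (ltW MN).
Qed.

Lemma bmf_Rintegral_cst r : \int[P]_x r = r.
Proof. by rewrite Rintegral_cst//= probability_setT mulr1. Qed.

Lemma bmf_RintegralD g h : bounded_mfun g -> bounded_mfun h ->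
  \int[P]_x (g x + h x) = \int[P]_x g x + \int[P]_x h x.
Proof. by move=> bg bh; apply: RintegralD => //; exact: bounded_mfun_integrable. Qed.

Lemma bmf_RintegralB g h : bounded_mfun g -> bounded_mfun h ->
  \int[P]_x (g x - h x) = \int[P]_x g x - \int[P]_x h x.
Proof. by move=> bg bh; apply: RintegralB => //; exact: bounded_mfun_integrable. Qed.

Lemma bmf_RintegralZl r g : bounded_mfun g ->
  \int[P]_x (r * g x) = r * \int[P]_x g x.
Proof. by move=> bg; apply: RintegralZl => //; exact: bounded_mfun_integrable. Qed.

Lemma bmf_le_Rintegral g h : bounded_mfun g -> bounded_mfun h ->
  (forall x, g x <= h x) -> \int[P]_x g x <= \int[P]_x h x.
Proof.
by move=> bg bh gh; apply: le_Rintegral => //; exact: bounded_mfun_integrable.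
Qed.

Lemma Rintegral_indic (A : set T) : measurable A ->
  \int[P]_x (\1_A x : R) = fine (P A).
Proof. by move=> mA; rewrite /Rintegral integral_indic// setIT. Qed.

End BoundedMeasurable.

Section Discrepancy.
Context (R : realType) d (T : measurableType d) (P Q : probability T R).

Lemma sum_ltn_ord (m j : nat) : (j <= m)%N ->
  \sum_(k < m) ((k < j)%N%:R : R) = j%:R.
Proof.
elim: m => [|m IHm] in j *; first by rewrite leqn0 => /eqP ->; rewrite big_ord0.
rewrite leq_eqVlt => /orP[/eqP ->|]; last first.
  by rewrite ltnS => jm; rewrite big_ord_recr/= IHm// ltnNge jm addr0.
under eq_bigr do rewrite ltn_ord.
by rewrite big_const_ord iter_addr_0.
Qed.

(* A layer-cake argument: [h] is uniformly close to an average of the indicators of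
   its superlevel sets. *)
Lemma superlevel_discrepancy (h : T -> R) (b tau : R) :
  measurable_fun setT h -> (forall x, 0 <= h x <= b) ->
  (forall s, fine (P [set x | s <= h x]) <= fine (Q [set x | s <= h x]) + tau) ->
  \int[P]_x h x <= \int[Q]_x h x + b * tau.
Proof.
move=> mh h0b Htau.
have bh : bounded_mfun h.
  by split=> //; exists b => x; have /andP[h0 hb] := h0b x; rewrite ger0_norm.
have b0 : 0 <= b by have /andP[h0 /(le_trans h0)] := h0b point.
suff H m : \int[P]_x h x <= \int[Q]_x h x + b * tau + b / m.+1%:R.
  apply/ler_addgt0Pr => e e0.
  apply: le_trans (H (Num.truncn (b / e))) _; rewrite lerD2l.
  rewrite ler_pdivrMr ?ltr0n// mulrC -ler_pdivrMr//.
  exact/ltW/truncnS_gt.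
pose q := b / m.+1%:R.
have q0 : 0 <= q by rewrite divr_ge0.
(* With mesh [q], [hm] below counts the levels reached by [h]: it is [h] rounded down to a multiple
   of [q]. *)
pose A (k : nat) := [set x | k.+1%:R * q <= h x].
have mA k : measurable (A k).
  rewrite -[A k]setTI; exact: (measurable_fun_le measurableT (measurable_cst _) mh).
have bA k : bounded_mfun (\1_(A k) : T -> R) by exact: bounded_mfun_indic.
pose hm x := q * \sum_(k < m.+1) (\1_(A k) x : R).
have bhs : bounded_mfun (fun x => \sum_(k < m.+1) (\1_(A k) x : R)).
  exact: bounded_mfun_sum.
have hmE x : hm x <= h x <= hm x + q.
  have /andP[h0 hb] := h0b x.
  (* A zero mesh means [b = 0], and then both [h] and [hm] vanish. *)
  have [qe|] := eqVneq q 0.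
    rewrite /hm qe mul0r addr0 h0/=; move: qe hb => /eqP.
    by rewrite mulf_eq0 invr_eq0 pnatr_eq0 orbF => /eqP ->.
  move=> qn; have {qn} qp : 0 < q by rewrite lt_def qn.
  pose j := Num.truncn (h x / q).
  have hq0 : 0 <= h x / q by rewrite divr_ge0.
  have /andP[jh hj] := truncn_itv hq0.
  rewrite /hm (eq_bigr (fun k : 'I_m.+1 => (k < j)%N%:R)); last first.
    move=> k _; rewrite indicE; congr (_%:R); congr nat_of_bool.
    rewrite /j truncn_ge_nat// ler_pdivlMr//.
    by apply/idP/idP => [/set_mem//|]; exact: mem_set.
  rewrite sum_ltn_ord; last first.
    rewrite -(ler_nat R); apply: le_trans jh _.
    by rewrite ler_pdivrMr// /q mulrCA divff ?pnatr_eq0// mulr1.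
  rewrite mulrC -ler_pdivlMr// jh/= -{2}(mul1r q) -mulrDl -ler_pdivrMr//.
  by rewrite natr1 ltW.
have bhm : bounded_mfun hm.
  by apply: bounded_mfunM => //; exact: bounded_mfun_cst.
(* Every level costs [tau]; multiplied by [q], the [m.+1] levels cost [b * tau] in all. *)
have HS l : \int[P]_x (\sum_(k < l) (\1_(A k) x : R)) <=
    \int[Q]_x (\sum_(k < l) (\1_(A k) x : R)) + l%:R * tau.
  elim: l => [|l IHl].
    under eq_Rintegral do rewrite big_ord0.
    under [in leRHS]eq_Rintegral do rewrite big_ord0.
    by rewrite !bmf_Rintegral_cst mul0r addr0.
  under eq_Rintegral do rewrite big_ord_recr/=.
  under [in leRHS]eq_Rintegral do rewrite big_ord_recr/=.
  rewrite !bmf_RintegralD//; try exact: bounded_mfun_sum.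
  rewrite !Rintegral_indic// -natr1 mulrDl mul1r.
  have := Htau (l.+1%:R * q); rewrite -/(A l); move: IHl; lra.
have Pm : \int[P]_x hm x <= \int[Q]_x hm x + b * tau.
  rewrite !bmf_RintegralZl//; apply: le_trans (ler_wpM2l q0 (HS m.+1)) _.
  by rewrite mulrDr mulrA /q divfK ?pnatr_eq0.
have P1 : \int[P]_x h x <= \int[P]_x (hm x + q).
  apply: bmf_le_Rintegral => //.
    by apply: bounded_mfunD => //; exact: bounded_mfun_cst.
  by move=> x; have /andP[] := hmE x.
have Q1 : \int[Q]_x hm x <= \int[Q]_x h x.
  by apply: bmf_le_Rintegral => // x; have /andP[] := hmE x.
rewrite bmf_RintegralD// ?bmf_Rintegral_cst in P1; last exact: bounded_mfun_cst.
rewrite -/q; lra.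
Qed.

End Discrepancy.

(** * Discrepancy of two laws from tail events *)

Section Oscillation.
Context (R : realType) (n : nat) (X : 'I_n -> ptopologicalType).
Variables (f : prod_space X -> R) (b : 'I_n -> R).

Definition coord_osc_le := forall (j : 'I_n) (x z : prod_space X),
  (forall k, k != j -> x k = z k) -> f x <= f z + b j.

Hypothesis osc_f : coord_osc_le.

(** The coordinates in [S] are changed one at a time, along [enum S]. *)
Lemma osc_le_sum (S : {set 'I_n}) (x z : prod_space X) :
  (forall k, k \notin S -> x k = z k) -> f x <= f z + \sum_(k in S) b k.
Proof.
rewrite -big_enum/=; have : uniq (enum S) by exact: enum_uniq.
move=> _ xz; have {xz} : forall k, k \notin enum S -> x k = z k.
  by move=> k; rewrite mem_enum; exact: xz.
elim: (enum S) x => [|j s IHs] x xz.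
  rewrite big_nil addr0 (_ : x = z)//.
  by apply: functional_extensionality_dep => k; exact: xz.
pose y : prod_space X := fun k => if k == j then z k else x k.
have fxy : f x <= f y + b j by apply: osc_f => k; rewrite /y => /negbTE ->.
have : f y <= f z + \sum_(k <- s) b k.
  apply: IHs => k ks; rewrite /y; case: eqP => // /eqP kj.
  by apply: xz; rewrite inE negb_or kj.
rewrite big_cons; lra.
Qed.

Lemma coord_osc_diam x z : f x <= f z + \sum_j b j.
Proof.
have := @osc_le_sum [set: 'I_n]%SET x z.
rewrite (eq_bigl xpredT) => [|k]; last by rewrite inE.
by apply=> k; rewrite inE.
Qed.

Lemma coord_osc_bounded : measurable_fun setT f -> bounded_mfun f.
Proof.
move=> mf; split=> //; exists (`|f point| + \sum_j b j) => x.
have := coord_osc_diam x point; have := coord_osc_diam point x.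
rewrite ler_norml; have := ler_norm (f point); have := ler_norm (- f point).
by rewrite normrN => ? ? ? ?; apply/andP; split; lra.
Qed.

End Oscillation.

Section TailDiscrepancy.
Context (R : realType) (n : nat) (X : 'I_n -> ptopologicalType).
Hypothesis polishX : forall i, polish R (X i).
Variables (P Q : probability (prod_space X) R).
Variables (f : prod_space X -> R) (b tau : 'I_n -> R).
Hypotheses (mf : measurable_fun setT f) (b_ge0 : forall j, 0 <= b j).
Hypothesis osc_f : coord_osc_le f b.

Definition tail_set (j : nat) (A : set (prod_space X)) :=
  forall x z : prod_space X, (forall k : 'I_n, (j <= k)%N -> x k = z k) -> A x -> A z.

Hypothesis tail_tau : forall (j : 'I_n) A, measurable A -> tail_set j A ->
  fine (P A) <= fine (Q A) + tau j.

Lemma tail_discrepancy :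
  \int[P]_x f x <= \int[Q]_x f x + \sum_j b j * tau j.
Proof.
pose M := \sum_j b j.
have M0 : 0 <= M by exact: sumr_ge0.
have fM x z : f x <= f z + M by exact: (coord_osc_diam osc_f).
pose y0 : prod_space X := point.
(* The shift places the values in [[0, 2 * M]], so that [2 * M] can serve as a cap in the minima
   below. *)
pose g x := f x - f y0 + M.
have g0 x : 0 <= g x by have := fM y0 x; rewrite /g; lra.
have gM x : g x <= 2 * M by have := fM x y0; rewrite /g; lra.
have osc_g : coord_osc_le g b.
  by move=> j x z /osc_f; rewrite /g; lra.
have bf : bounded_mfun f by exact: (coord_osc_bounded osc_f).
have bfy : bounded_mfun (fun x => f x - f y0).
  by apply: bounded_mfunB => //; exact: bounded_mfun_cst.
have bg : bounded_mfun g.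
  by apply: bounded_mfunD => //; exact: bounded_mfun_cst.
(* The error [e] comes from rounding [g] to multiples of [e], and [2 * M * e] from the mass that [Q]
   leaves outside the compact sets. *)
suff main e : 0 < e ->
    \int[P]_x g x <= \int[Q]_x g x + \sum_j b j * tau j + (e + 2 * M * e).
  have gE (P' : probability (prod_space X) R) :
      \int[P']_x g x = \int[P']_x f x - f y0 + M.
    rewrite (bmf_RintegralD P' bfy (bounded_mfun_cst _ M)).
    by rewrite (bmf_RintegralB P' bf (bounded_mfun_cst _ (f y0))) !bmf_Rintegral_cst.
  apply/ler_addgt0Pr => e e0.
  have M1 : 0 < 1 + 2 * M by lra.
  have /main : 0 < e / (1 + 2 * M) by rewrite divr_gt0.
  have : e / (1 + 2 * M) * (1 + 2 * M) = e by rewrite divfK// gt_eqF.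
  by rewrite !gE; set q := e / _; lra.
move=> e0.
pose N := (Num.truncn (2 * M / e)).+1.
have MN : 2 * M < N%:R * e by rewrite -ltr_pdivrMr//; exact: truncnS_gt.
pose L (v : nat) := [set x | v%:R * e <= g x < v.+1%:R * e].
have mL v : measurable (L v).
  rewrite (_ : L v =
      [set x | v%:R * e <= g x] `&` ~` [set x | v.+1%:R * e <= g x]).
    apply: measurableI; last apply: measurableC.
      rewrite -[X in measurable X]setTI.
      exact: (measurable_fun_le measurableT (measurable_cst _) bg.1).
    rewrite -[X in measurable X]setTI.
    exact: (measurable_fun_le measurableT (measurable_cst _) bg.1).
  apply/seteqP; split => x /=; last first.
    by move=> [h1 /negP]; rewrite -ltNge => h2; apply/andP.
  by move=> /andP[h1 h2]; split => //; apply/negP; rewrite -ltNge.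
have /choice[K KP] : forall v : nat, exists K : set (forall i, X i), [/\ K `<=` L v,
    (Q (L v `\` K) <= (e / (2 ^ v.+1)%:R)%:E)%E &
    forall S, measurable (saturation S K : set (prod_space X))].
  by move=> v; apply: polish_inner_regular => //; rewrite divr_gt0.
(* A point lies in [C j (v, S)] when it agrees with some [w] in [K v] on the coordinates from [j] on
   outside [S]. Hence [G j x] is the infimum over such [w] of the rounded value [v%:R * e] plus the
   [b k] with [j <= k] and [w k] different from [x k], capped at [2 * M]. As a minimum over finitely
   many pairs it is measurable. *)
pose C j (p : 'I_N * {set 'I_n}) : set (prod_space X) :=
  saturation [set k : 'I_n | (j <= k)%N && (k \notin p.2)] (K p.1).
pose cost (p : 'I_N * {set 'I_n}) : R := p.1%:R * e + \sum_(k in p.2) b k.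
have mC j p : measurable (C j p) by have [_ _] := KP p.1; apply.
pose F j p x : R := 2 * M + (cost p - 2 * M) * \1_(C j p) x.
pose G j x : R := \big[Num.min/(2 * M)]_p F j p x.
have FE j p x : F j p x = if x \in C j p then cost p else 2 * M.
  by rewrite /F indicE; case: (_ \in _); rewrite ?mulr1 ?mulr0; lra.
have cost0 p : 0 <= cost p.
  by apply: addr_ge0; [rewrite mulr_ge0// ltW|exact: sumr_ge0].
have bG j : bounded_mfun (G j).
  apply: bounded_mfun_bigmin => p; apply: bounded_mfunD; first exact: bounded_mfun_cst.
  apply: bounded_mfunM; first exact: bounded_mfun_cst.
  exact: bounded_mfun_indic.
have G0 j x : 0 <= G j x.
  apply/bigmin_geP; split => [|p _]; first by lra.
  by rewrite FE; case: ifP => // _; lra.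
have GM j x : G j x <= 2 * M by exact: bigmin_le_id.
have G_tail j x z : (forall k : 'I_n, (j <= k)%N -> x k = z k) -> G j x = G j z.
  move=> xz; apply: eq_bigr => p _; rewrite !FE.
  rewrite (_ : (x \in C j p) = (z \in C j p))//.
  apply/idP/idP => /set_mem[w Kw wx]; apply/mem_set; exists w => // k;
    move=> /[dup] /wx -> /andP[/xz].
    by [].
  by move=> ->.
(* [C j p] grows with [j], so [G j x] decreases in [j]. Conversely a pair admissible from [j.+1] on
   becomes admissible from [j] on once [j] joins [S], which costs at most [b j]. *)
have G_step (j : 'I_n) x : 0 <= G j x - G j.+1 x <= b j.
  apply/andP; split.
    rewrite subr_ge0; apply/bigmin_geP; split => // p _; rewrite FE.
    case: ifPn => [/set_mem[w Kw wx]|_ //].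
    apply: (bigmin_inf p) => //; rewrite FE mem_set//; exists w => // k /andP[jk kp].
    by apply: wx; rewrite /= kp (ltnW jk).
  rewrite lerBlDr -lerBlDl; apply/bigmin_geP; split.
    by have := GM j x; have := b_ge0 j; lra.
  move=> [v S] _; rewrite FE lerBlDl; case: ifPn => [/set_mem[w Kw wx]|_]; last first.
    by have := GM j x; have := b_ge0 j; lra.
  apply: (bigmin_inf (v, j |: S)%SET) => //; rewrite FE mem_set; last first.
    exists w => // k; rewrite /= !inE negb_or => /andP[jk /andP[kj kS]].
    by apply: wx; rewrite /= kS andbT ltn_neqAle jk andbT eq_sym -val_eqE in kj *.
  rewrite /cost/= addrCA lerD2l.
  have [jS|jS] := boolP (j \in S); last by rewrite big_setU1.
  by rewrite (finset.setUidPr _) ?finset.sub1set//; have := b_ge0 j; lra.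
have G_last x z : G n x = G n z.
  by apply: G_tail => k; rewrite leqNgt ltn_ord.
(* If [w] in [K v] agrees with [x] outside [S], then [g x] is at most [g w] plus the [b k] over [S],
   and [g w] is below [v.+1%:R * e]. *)
have gG x : g x <= G 0%N x + e.
  rewrite -lerBlDr; apply/bigmin_geP; split => [|[v S] _]; first by have := gM x; lra.
  rewrite FE; case: ifPn => [/set_mem[w Kw wx]|_]; last by have := gM x; lra.
  have gxw : g x <= g w + \sum_(k in S) b k.
    by apply: (osc_le_sum osc_g) => k kS; rewrite wx//= kS.
  have [/(_ _ Kw) /andP[_]] := KP v; rewrite -natr1 mulrDl mul1r /cost /=; lra.
pose KK : set (prod_space X) := \bigcup_v K v.
have mK v : measurable (K v : set (prod_space X)).
  have [_ _ /(_ setT)] := KP v; congr measurable.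
  apply/seteqP; split => [x [w Kw wx]|x Kx]; last by exists x.
  by rewrite (_ : x = w)//; apply: functional_extensionality_dep => k; rewrite wx.
have mKK : measurable KK by exact: bigcupT_measurable.
have QKK : fine (Q (~` KK)) <= e.
  rewrite -lee_fin fineK; last by apply: fin_num_measure; exact: measurableC.
  apply: le_trans (epsilon_trick0 xpredT (ltW e0)).
  apply: (@le_trans _ _ (\sum_(v <oo) Q (L v `\` K v))%E).
    apply: measure_sigma_subadditive => //.
    - by move=> v; exact: measurableD.
    - exact: measurableC.
    - move=> x Kx; exists (Num.truncn (g x / e)) => //; split; last first.
        by move=> Kvx; apply: Kx; exists (Num.truncn (g x / e)).
      have /truncn_itv/andP[] : 0 <= g x / e by rewrite divr_ge0// ltW.
      by rewrite ler_pdivlMr// ltr_pdivrMr// => h1 h2; rewrite /L/= h1.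
  by apply: lee_nneseries => // v _; have [] := KP v.
(* A point of [K v] is its own witness, with [S] empty and cost [v%:R * e], at most [g x]; off the
   compact sets the cap is used. *)
have Gg x : G 0%N x <= g x + 2 * M * \1_(~` KK) x.
  rewrite indicE; have [_|] := boolP (x \in ~` KK).
    by rewrite mulr1; have := GM 0%N x; have := g0 x; lra.
  move=> /negP xK; have [v _ Kvx] : KK x.
    by apply: contrapT => h; apply: xK; exact: mem_set.
  have [/(_ _ Kvx) /andP[vg _] _ _] := KP v.
  have vN : (v < N)%N.
    by rewrite -(ltr_nat R) -(ltr_pM2r e0); apply: le_lt_trans vg (le_lt_trans (gM x) MN).
  rewrite mulr0 addr0; apply: (bigmin_inf (Ordinal vN, finset.set0)) => //.
  by rewrite FE mem_set; [rewrite /cost/= big_set0 addr0|exists x].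
pose a m := \int[P]_x G m x - \int[Q]_x G m x.
(* The increment takes values in [[0, b j]] and depends on the coordinates from [j] on, so its
   superlevel sets are tail sets. *)
have a_step (j : 'I_n) : a j - a j.+1 <= b j * tau j.
  rewrite /a; have : \int[P]_x (G j x - G j.+1 x) <=
      \int[Q]_x (G j x - G j.+1 x) + b j * tau j.
    apply: superlevel_discrepancy => //.
      by have [] : bounded_mfun (fun x => G j x - G j.+1 x) by exact: bounded_mfunB.
    move=> s; apply: tail_tau.
      rewrite -[X in measurable X]setTI.
      apply: (measurable_fun_le measurableT (measurable_cst _)).
      by have [] : bounded_mfun (fun x => G j x - G j.+1 x) by exact: bounded_mfunB.
    move=> x z xz /=; rewrite (G_tail _ _ _ xz) (G_tail j.+1 x z)// => k jk.
    by apply: xz; exact: ltnW.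
  by rewrite !bmf_RintegralB//; lra.
have an : a n = 0.
  have Gn (P' : probability (prod_space X) R) : \int[P']_x G n x = G n y0.
    rewrite -(bmf_Rintegral_cst P' (G n y0)); apply: eq_Rintegral => x _.
    exact: G_last.
  by rewrite /a !Gn subrr.
have a0 : a 0%N <= \sum_j b j * tau j.
  have := @telescope_sumr _ 0 n (fun k => - a k) (leq0n n).
  rewrite an oppr0 sub0r opprK => <-; rewrite big_mkord; apply: ler_sum => j _.
  by rewrite opprK addrC; exact: a_step.
have P1 : \int[P]_x g x <= \int[P]_x (G 0%N x + e).
  apply: bmf_le_Rintegral => //.
  by apply: bounded_mfunD => //; exact: bounded_mfun_cst.
have b1 : bounded_mfun (fun x => 2 * M * (\1_(~` KK) x : R)).
  apply: bounded_mfunM; first exact: bounded_mfun_cst.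
  by apply: bounded_mfun_indic; exact: measurableC.
have Q1 : \int[Q]_x G 0%N x <= \int[Q]_x (g x + 2 * M * \1_(~` KK) x).
  by apply: bmf_le_Rintegral => //; exact: bounded_mfunD.
move: P1 Q1; rewrite (bmf_RintegralD P (bG 0%N) (bounded_mfun_cst _ e)).
rewrite bmf_Rintegral_cst (bmf_RintegralD Q bg b1).
rewrite bmf_RintegralZl; last by apply: bounded_mfun_indic; exact: measurableC.
rewrite Rintegral_indic; last exact: measurableC.
have : 2 * M * fine (Q (~` KK)) <= 2 * M * e by rewrite ler_wpM2l//; lra.
move: a0; rewrite /a; lra.
Qed.

End TailDiscrepancy.

(** * Hoeffding's lemma *)

Section BernoulliMgf.
Context (R : realType).

Lemma is_derive_ge0 (f df : R -> R) :
  (forall x : R, is_derive x 1 f (df x)) -> f 0 = 0 ->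
  (forall x, 0 <= x -> 0 <= df x) -> forall s, 0 <= s -> 0 <= f s.
Proof.
move=> fd f0 df0 s; rewrite le_eqVlt => /orP[/eqP <-|s0]; first by rewrite f0.
have [|x xs] := @MVT _ f df 0 s s0 (fun x _ => fd x).
  apply: derivable_within_continuous => x _.
  by have [] := fd x.
rewrite f0 !subr0 => ->; apply: mulr_ge0; last exact: ltW.
by apply: df0; move: xs; rewrite in_itv/= => /andP[/ltW].
Qed.

Variable p : R.
Hypothesis p01 : 0 <= p <= 1.

Let w (s : R) : R := 1 - p + p * expR s.

Let w_gt0 s : 0 < w s.
Proof.
have /andP[p0 p1] := p01; have es := expR_gt0 s; rewrite /w.
move: p0; rewrite le_eqVlt => /orP[/eqP <-|p0]; first by lra.
by have := mulr_gt0 p0 es; lra.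
Qed.

Let is_derive_w (s : R) : is_derive s 1 w (p * expR s).
Proof.
rewrite (_ : w = cst (1 - p) + p \*: expR); last by apply/funext.
by apply: is_derive_eq; rewrite add0r.
Qed.

Let k (s : R) : R := s / 4 + p - 1 + (1 - p) * (w s)^-1.

Let is_derive_k (s : R) :
  is_derive s 1 k (4^-1 - (1 - p) / w s * (1 - (1 - p) / w s)).
Proof.
have ws0 : w s != 0 by rewrite gt_eqF.
have wV := is_deriveV ws0 (is_derive_w s).
rewrite (_ : k = (4^-1 \*: id) + cst (p - 1) + (1 - p) \*: (fun x => (w x)^-1)).
  apply: is_derive_eq.
  rewrite /GRing.scale /= mulr1 addr0 (_ : p * expR s = w s - (1 - p)); last by rewrite /w; ring.
  by field.
by apply/funext => x; rewrite /k /= /GRing.scale /= addrA mulrC.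
Qed.

(** The function [h], the logarithm of the right side minus that of the left, has derivative [k].
    Both vanish at 0, and the derivative of [k] is 1/4 - r(1 - r) = (r - 1/2)^2 with r = (1 - p)/w,
    so two integrations give the sign. *)
Lemma bernoulli_mgf_ge0 (s : R) : 0 <= s ->
  1 - p + p * expR s <= expR (p * s + s ^+ 2 / 8).
Proof.
have k_ge0 : forall s, 0 <= s -> 0 <= k s.
  apply: (is_derive_ge0 is_derive_k).
    by rewrite /k /w expR0 mulr1 subrK invr1; lra.
  by move=> x _; set r := _ / _; have := sqr_ge0 (r - 1 / 2); rewrite expr2; lra.
pose h (x : R) : R := x ^+ 2 / 8 + p * x - ln (w x).
have is_derive_h (x : R) : is_derive x 1 h (k x).
  have lnw : is_derive x 1 (@ln R \o w) ((w x)^-1 * (p * expR x)).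
    by apply: is_derive1_comp (is_derive_w x); apply: is_derive1_ln.
  rewrite (_ : h = (8^-1 \*: (id ^+ 2)) + (p \*: id) - (@ln R \o w)).
    apply: is_derive_eq; rewrite /GRing.scale /= expr1 !mulr1 /k.
    rewrite (_ : p * expR x = w x - (1 - p)); last by rewrite /w; ring.
    by field; rewrite gt_eqF.
  apply/funext => y.
  by change (y ^+ 2 / 8 + p * y - ln (w y) = 8^-1 * y ^+ 2 + p * y - ln (w y)); ring.
move=> s0.
have : 0 <= h s.
  apply: (is_derive_ge0 is_derive_h) => //.
  by rewrite /h /w expR0 mulr1 subrK ln1 expr0n/=; lra.
rewrite /h subr_ge0 -ler_expR lnK ?posrE// => /le_trans; apply.
by rewrite addrC.
Qed.

End BernoulliMgf.

(** For negative [s], the previous bound is used with [1 - p] and [- s], and multiplied by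
    [expR s]. *)
Lemma bernoulli_mgf (R : realType) (p s : R) : 0 <= p <= 1 ->
  1 - p + p * expR s <= expR (p * s + s ^+ 2 / 8).
Proof.
move=> p01; have [s0|s0] := leP 0 s; first exact: bernoulli_mgf_ge0.
have p01' : 0 <= 1 - p <= 1 by move: p01 => /andP[? ?]; apply/andP; split; lra.
have := @bernoulli_mgf_ge0 _ _ p01' (- s) ltac:(lra).
rewrite -(ler_pM2r (expR_gt0 s)) -expRD mulrDl -mulrA -expRD addNr expR0.
set a := expR s.
rewrite (_ : _ + s = p * s + s ^+ 2 / 8); last by rewrite sqrrN; ring.
by apply: le_trans; rewrite mulr1; lra.
Qed.

(** Convexity of the exponential, from 1 + x <= exp x at x = -qs and x = (1-q)s. With weights 1-q
    and q the linear terms cancel, and multiplying by exp(qs) gives the chord. *)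
Lemma expR_chord (R : realType) (q s : R) : 0 <= q <= 1 ->
  expR (q * s) <= 1 - q + q * expR s.
Proof.
move=> /andP[q0 q1].
have h0 : 1 - q * s <= expR (- (q * s)) by apply: expR_ge1Dx.
have h1 : 1 + (1 - q) * s <= expR ((1 - q) * s) by apply: expR_ge1Dx.
have q1' : 0 <= 1 - q by lra.
have hE : expR (q * s) * expR (- (q * s)) = 1 by rewrite -expRD subrr expR0.
have -> : expR s = expR (q * s) * expR ((1 - q) * s).
  by rewrite -expRD; congr expR; ring.
have := ler_wpM2l q1' h0; have := ler_wpM2l q0 h1.
move: hE (expR_ge0 (q * s)).
set E := expR (q * s); set Y := expR (- _); set Z := expR (_ * _).
move=> EY E0 hZ hY.
have : E * 1 <= E * ((1 - q) * Y + q * Z) by apply: ler_wpM2l => //; lra.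
by rewrite mulr1 mulrDr mulrCA EY mulr1 (mulrCA E q).
Qed.

(** Writing g = a + cq with q in [0, 1], the chord bound makes the integrand affine in q; its
    integral is the Bernoulli expression with parameter the mean of q. *)
Lemma hoeffding_mgf (R : realType) d (T : measurableType d) (P : probability T R)
    (g : T -> R) (c s : R) :
  bounded_mfun g -> (forall x y, g x <= g y + c) ->
  \int[P]_x expR (s * g x) <= expR (s * \int[P]_x g x + s ^+ 2 * c ^+ 2 / 8).
Proof.
move=> bg gc.
have c0 : 0 <= c by have := gc point point; lra.
pose a := inf (range g).
have ag x : a <= g x.
  apply: ge_inf; last by exists x.
  have [_ [M gM]] := bg; exists (- M) => _ [y _ <-].
  by move: (gM y); rewrite ler_norml => /andP[].
have ga x : g x <= a + c.
  rewrite -lerBlDr; apply: lb_le_inf; first by exists (g point), point.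
  by move=> _ [y _ <-]; rewrite lerBlDr.
pose q x := c^-1 * (g x - a).
have q01 x : 0 <= q x <= 1.
  rewrite /q mulr_ge0 ?invr_ge0 ?subr_ge0//=.
  move: c0; rewrite le_eqVlt => /orP[/eqP <-|c0]; first by rewrite invr0 mul0r.
  by rewrite ler_pdivrMl// mulr1; have := ga x; lra.
have gq x : g x = a + c * q x.
  (* For [c = 0] the inverse is 0, hence [q] is 0 and [g] is constantly [a]. *)
  rewrite /q mulrA; have [c00|cn0] := eqVneq c 0.
    by rewrite c00 !mul0r addr0; have := ag x; have := ga x; rewrite c00; lra.
  by rewrite divff// mul1r; lra.
have bq : bounded_mfun q.
  apply: bounded_mfunM; first exact: bounded_mfun_cst.
  by apply: bounded_mfunB => //; exact: bounded_mfun_cst.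
pose p := \int[P]_x q x.
have p01 : 0 <= p <= 1.
  apply/andP; split; first by apply: Rintegral_ge0 => x _; have /andP[] := q01 x.
  rewrite -(bmf_Rintegral_cst P 1); apply: bmf_le_Rintegral => //.
    exact: bounded_mfun_cst.
  by move=> x; have /andP[] := q01 x.
have Pg : \int[P]_x g x = a + c * p.
  rewrite (@eq_Rintegral _ _ _ P setT (fun x => a + c * q x)) => [|x _]; last exact: gq.
  have bcq : bounded_mfun (fun x => c * q x).
    by apply: bounded_mfunM => //; exact: bounded_mfun_cst.
  rewrite (bmf_RintegralD P (bounded_mfun_cst _ a) bcq) bmf_Rintegral_cst.
  by rewrite bmf_RintegralZl.
pose r x := expR (s * a) + (expR (s * a) * (expR (c * s) - 1)) * q x.
have br1 : bounded_mfun (fun x => (expR (s * a) * (expR (c * s) - 1)) * q x).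
  by apply: bounded_mfunM => //; exact: bounded_mfun_cst.
have br : bounded_mfun r.
  by apply: bounded_mfunD => //; exact: bounded_mfun_cst.
apply: (@le_trans _ _ (\int[P]_x r x)).
  apply: bmf_le_Rintegral => // [|x].
    apply: bounded_mfun_expR; apply: bounded_mfunM => //; exact: bounded_mfun_cst.
  have := expR_chord (c * s) (q01 x) => /(ler_wpM2l (expR_ge0 (s * a))).
  rewrite -expRD (_ : s * a + _ = s * g x); last by rewrite gq; ring.
  by rewrite /r; lra.
rewrite (bmf_RintegralD P (bounded_mfun_cst _ (expR (s * a))) br1).
rewrite bmf_Rintegral_cst bmf_RintegralZl// -/p Pg.
have := bernoulli_mgf (c * s) p01 => /(ler_wpM2l (expR_ge0 (s * a))).
rewrite -expRD.
rewrite (_ : s * a + (p * (c * s) + _) = s * (a + c * p) + s ^+ 2 * c ^+ 2 / 8);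
  last by ring.
by apply: le_trans; rewrite le_eqVlt; apply/orP; left; apply/eqP; ring.
Qed.

(** * Conditional expectations given by kernels *)

Lemma measurable_fun_prod_space (J : Type) (Y : J -> ptopologicalType)
    d (T : measurableType d) (h : T -> prod_space Y) :
  (forall j B, borel (Y j) B -> measurable [set t | B (h t j)]) ->
  measurable_fun setT h.
Proof.
move=> mh; apply: (@measurability _ _ T (prod_space Y) setT h (coord_cylinders Y)) => //.
by move=> _ [_ [j _ [B bB <-]] <-]; rewrite !setTI; exact: mh.
Qed.

Definition mfun_of d d' (T : measurableType d) (T' : measurableType d')
    (h : T -> T') (mh : measurable_fun setT h) : {mfun T >-> T'} :=
  HB.pack h (isMeasurableFun.Build _ _ _ _ h mh).

Section KernelProbability.
Context (R : realType) d d' (T : measurableType d) (T' : measurableType d').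
Variables (k : R.-pker T ~> T') (x : T).

Definition pker_prob : set T' -> \bar R := k x.

HB.instance Definition _ := Measure.on pker_prob.

HB.instance Definition _ :=
  Measure_isProbability.Build _ _ _ pker_prob (prob_kernel x).

End KernelProbability.

Section Glue.
Context (n : nat) (X : 'I_n -> ptopologicalType) (i : 'I_n).

Lemma notin_upto_after (k : 'I_n) : k \notin upto i -> k \in after i.
Proof. by rewrite !inE -ltnNge. Qed.

Definition splice (u : sub_space X (upto i)) (v : sub_space X (after i)) :
    prod_space X :=
  fun k => match boolP (k \in upto i) with
           | AltTrue h => u (exist _ k h)
           | AltFalse h => v (exist _ k (notin_upto_after h))
           end.

Lemma splice_upto u v (k : 'I_n) (h : k \in upto i) : splice u v k = u (exist _ k h).
Proof.
rewrite /splice; case: {-}_ / boolP => h'; last by exfalso; move: h'; rewrite h.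
by rewrite (bool_irrelevance h h').
Qed.

Lemma splice_after u v (k : 'I_n) (h : k \in after i) : splice u v k = v (exist _ k h).
Proof.
rewrite /splice; case: {-}_ / boolP => h'.
  by exfalso; move: h h'; rewrite !inE ltnNge => /negP.
by rewrite (bool_irrelevance h (notin_upto_after h')).
Qed.

Lemma splice_restr (x : prod_space X) :
  splice (restr (upto i) x) (restr (after i) x) = x.
Proof.
apply: functional_extensionality_dep => k.
by rewrite /splice; case: {-}_ / boolP.
Qed.

Lemma restr_upto_splice u v : restr (upto i) (splice u v) = u.
Proof.
apply: functional_extensionality_dep => -[k h].
by rewrite /restr /= (splice_upto _ _ h).
Qed.

Lemma restr_after_splice u v : restr (after i) (splice u v) = v.
Proof.
apply: functional_extensionality_dep => -[k h].
by rewrite /restr /= (splice_after _ _ h).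
Qed.

Lemma measurable_restr (I : {set 'I_n}) :
  measurable_fun setT (restr I : prod_space X -> sub_space X I).
Proof. by apply: measurable_fun_prod_space => j B; exact: measurable_coord_preimage. Qed.

Lemma measurable_splice :
  measurable_fun setT (fun p : sub_space X (upto i) * sub_space X (after i) =>
    splice p.1 p.2).
Proof.
apply: measurable_fun_prod_space => k B bB.
have [h|/notin_upto_after h] := boolP (k \in upto i).
  rewrite [X in measurable X](_ : _ =
      fst @^-1` [set u : sub_space X (upto i) | B (u (exist _ k h))]); last first.
    by apply/seteqP; split => -[u v] /=; rewrite (splice_upto _ _ h).
  rewrite -[X in measurable X]setTI; apply: measurable_fst => //.
  exact: (@measurable_coord_preimage _ (fun j : {j | j \in upto i} => X (val j))
    (exist _ k h)).
rewrite [X in measurable X](_ : _ =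
    snd @^-1` [set v : sub_space X (after i) | B (v (exist _ k h))]); last first.
  by apply/seteqP; split => -[u v] /=; rewrite (splice_after _ _ h).
rewrite -[X in measurable X]setTI; apply: measurable_snd => //.
exact: (@measurable_coord_preimage _ (fun j : {j | j \in after i} => X (val j))
  (exist _ k h)).
Qed.

Lemma measurable_splicer u : measurable_fun setT (splice u).
Proof.
exact: (measurableT_comp measurable_splice (pair1_measurable u)).
Qed.

End Glue.

Section Disintegration.
Context (R : realType) (n : nat) (X : 'I_n -> ptopologicalType).
Variables (mu : probability (prod_space X) R) (K : cond_laws R X) (i : 'I_n).

Let U := restr (upto i) : prod_space X -> sub_space X (upto i).

(** The conditional law of the whole sequence given its past, with the past of [x] frozen. Living on
    the full space, it makes all conditional expectations functions on one space. *)
Definition splice_law (x : prod_space X) : probability (prod_space X) R :=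
  distribution (pker_prob (K i) (U x)) (mfun_of (measurable_splicer (U x))).

(** The factor [unit] is the format in which [mkcomp] composes this kernel with [mu], itself seen as
    a kernel from [unit]. *)
Definition splice_ker (p : unit * prod_space X) :
  {measure set (prod_space X) -> \bar R} := splice_law p.2.

Let measurable_splice_ker A : measurable A -> measurable_fun setT (splice_ker ^~ A).
Proof.
move=> mA.
pose B := [set p : sub_space X (upto i) * sub_space X (after i) | A (splice p.1 p.2)].
have mB : measurable B by rewrite -[B]setTI; exact: measurable_splice.
have mk : measurable_fun setT (fun u => K i u (xsection B u)).
  by apply: measurable_fun_xsection_finite_kernel; rewrite inE.
rewrite [X in measurable_fun _ X](_ : _ = (fun u => K i u (xsection B u)) \o U \o snd).
  apply: measurableT_comp; last exact: measurable_snd.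
  by apply: measurableT_comp mk _; exact: measurable_restr.
apply/funext => -[[] x] /=; congr (K i _ _).
apply/seteqP; split => v /=; rewrite /xsection /B /=; last by move/set_mem.
by move=> h; exact/mem_set.
Qed.

HB.instance Definition _ :=
  isKernel.Build _ _ _ _ R splice_ker measurable_splice_ker.

Let splice_ker_prob p : splice_ker p setT = 1%E.
Proof. exact: (probability_setT (splice_law p.2)). Qed.

HB.instance Definition _ :=
  Kernel_isProbability.Build _ _ _ _ R splice_ker splice_ker_prob.

Let mu_ker : R.-pker unit ~> prod_space X :=
  kprobability (measurable_cst (mu : pprobability (prod_space X) R)).

Hypothesis condK : is_cond_laws mu K.

Let mix : {measure set (prod_space X) -> \bar R} := mkcomp mu_ker splice_ker tt.

(** The defining property of the conditional laws is this identity on rectangles of past and future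
    events, a generating family closed under intersection. *)
Let mixE A : measurable A -> mu A = mix A.
Proof.
pose G := [set restr (upto i) @^-1` A `&` restr (after i) @^-1` B |
  A in (@measurable _ (sub_space X (upto i))) &
  B in (@measurable _ (sub_space X (after i)))].
have mU : measurable_fun setT U by exact: measurable_restr.
have mV : measurable_fun setT (restr (after i) : prod_space X -> _).
  exact: measurable_restr.
apply: (@measure_unique _ _ _ G (fun=> setT)) => //.
- apply/seteqP; split.
    apply: smallest_sub; first exact: smallest_sigma_algebra.
    move=> _ [j _ [B bB <-]]; rewrite setTI; apply: sub_sigma_algebra.
    have [h|/notin_upto_after h] := boolP (j \in upto i).
      exists [set u : sub_space X (upto i) | B (u (exist _ j h))].
        exact: (@measurable_coord_preimage _ (fun j : {j | j \in upto i} => X (val j))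
          (exist _ j h)).
      by exists setT => //; rewrite preimage_setT setIT.
    exists setT => //.
    exists [set v : sub_space X (after i) | B (v (exist _ j h))].
      exact: (@measurable_coord_preimage _ (fun j : {j | j \in after i} => X (val j))
        (exist _ j h)).
    by rewrite preimage_setT setTI.
  apply: smallest_sub; first exact: sigma_algebra_measurable.
  move=> _ [B mB [C mC <-]]; apply: measurableI.
    by rewrite -[X in measurable X]setTI; exact: mU.
  by rewrite -[X in measurable X]setTI; exact: mV.
- move=> _ _ [B1 mB1 [C1 mC1 <-]] [B2 mB2 [C2 mC2 <-]].
  exists (B1 `&` B2); first exact: measurableI.
  exists (C1 `&` C2); first exact: measurableI.
  by rewrite !preimage_setI setIACA.
- by move=> _; exists setT => //; exists setT => //; rewrite !preimage_setT setTI.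
- by rewrite bigcup_const//; exists 0%N.
- move=> _ [B mB [C mC <-]]; apply: etrans; first exact: (condK (i := i) mB mC).
  rewrite /mix /mkcomp /kcomp /= integral_mkcond; apply: eq_integral => x _.
  rewrite patchE; case: ifPn => [/set_mem|/negP] Ux.
    congr (K i _ _); apply/seteqP; split => v /=.
      by move=> Cv; split => /=; rewrite ?restr_upto_splice ?restr_after_splice.
    by move=> [_] /=; rewrite restr_after_splice.
  have E0 : splice (U x) @^-1` (restr (upto i) @^-1` B `&` restr (after i) @^-1` C) = set0.
    apply/seteqP; split => v //= [] /=; rewrite restr_upto_splice => Bx _.
    by apply: Ux; exact: mem_set.
  apply: etrans (esym (congr1 (K i (U x)) E0)).
  by rewrite measure0.
- move=> _; apply: (le_lt_trans (probability_le1 mu measurableT)).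
  exact: ltry.
Qed.

Let integral_splice_law (phi : prod_space X -> \bar R) :
  (forall x, (0 <= phi x)%E) -> measurable_fun setT phi ->
  (\int[mu]_x \int[splice_law x]_y phi y = \int[mu]_x phi x)%E.
Proof.
move=> phi0 mphi.
rewrite [RHS](@eq_measure_integral _ _ _ _ mix); last by move=> A mA _; exact: mixE.
by rewrite integral_kcomp.
Qed.

Let measurable_integral_splice_law (phi : prod_space X -> \bar R) :
  (forall x, (0 <= phi x)%E) -> measurable_fun setT phi ->
  measurable_fun setT (fun x => \int[splice_law x]_y phi y)%E.
Proof.
move=> phi0 mphi; apply: measurable_fun_integral_kernel => // A mA.
exact: (measurableT_comp (measurable_splice_ker mA) (pair1_measurable tt)).
Qed.

Definition cond_exp (phi : prod_space X -> R) (x : prod_space X) : R :=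
  \int[splice_law x]_y phi y.

(** Reduces bounded functions to nonnegative ones, for which the kernel results above are stated. *)
Let cond_exp_shift phi M x : bounded_mfun phi ->
  cond_exp phi x = cond_exp (fun y => phi y + M) x - M.
Proof.
move=> bphi; rewrite /cond_exp bmf_RintegralD//; last exact: bounded_mfun_cst.
by rewrite bmf_Rintegral_cst addrK.
Qed.

Let bounded_mfun_cond_exp_ge0 phi : bounded_mfun phi -> (forall x, 0 <= phi x) ->
  bounded_mfun (cond_exp phi).
Proof.
move=> bphi phi0; have [mphi [M phiM]] := bphi; split.
  apply: measurableT_comp; first exact: fine_measurable.
  by apply: measurable_integral_splice_law => //; exact/measurable_EFinP.
exists M => x; rewrite ger0_norm; last exact: Rintegral_ge0.
rewrite -[leRHS](bmf_Rintegral_cst (splice_law x)).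
apply: bmf_le_Rintegral => //; first exact: bounded_mfun_cst.
by move=> y; apply: le_trans (phiM y); exact: ler_norm.
Qed.

Lemma bounded_mfun_cond_exp phi : bounded_mfun phi -> bounded_mfun (cond_exp phi).
Proof.
move=> bphi; have [_ [M phiM]] := bphi.
rewrite (_ : cond_exp phi = fun x => cond_exp (fun y => phi y + M) x - M).
  apply: bounded_mfunB; last exact: bounded_mfun_cst.
  apply: bounded_mfun_cond_exp_ge0.
    by apply: bounded_mfunD => //; exact: bounded_mfun_cst.
  by move=> x; have := phiM x; rewrite ler_norml => /andP[+ _]; lra.
by apply/funext => x; exact: cond_exp_shift.
Qed.

Lemma Rintegral_cond_exp phi : bounded_mfun phi ->
  \int[mu]_x cond_exp phi x = \int[mu]_x phi x.
Proof.
move=> bphi; have [mphi [M phiM]] := bphi.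
pose psi y := phi y + M.
have bpsi : bounded_mfun psi.
  by apply: bounded_mfunD => //; exact: bounded_mfun_cst.
have psi0 x : 0 <= psi x.
  by have := phiM x; rewrite ler_norml /psi => /andP[+ _]; lra.
have psiE : \int[mu]_x cond_exp psi x = \int[mu]_x psi x.
  congr fine; rewrite -[RHS]integral_splice_law//; last first.
    by apply/measurable_EFinP; exact: bpsi.1.
  apply: eq_integral => x _; rewrite /cond_exp fineK//.
  by apply: integrable_fin_num => //; exact: bounded_mfun_integrable.
rewrite (@eq_Rintegral _ _ _ mu setT (fun x => cond_exp psi x - M)); last first.
  by move=> x _; exact: cond_exp_shift.
rewrite (bmf_RintegralB mu (bounded_mfun_cond_exp bpsi) (bounded_mfun_cst _ M)).
rewrite psiE (bmf_RintegralD mu bphi (bounded_mfun_cst _ M)).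
by rewrite !bmf_Rintegral_cst addrK.
Qed.

End Disintegration.

(** * Oscillations and the mixing matrix *)

Section LocalOscillation.
Context (R : realType) (n : nat) (X : 'I_n -> ptopologicalType).

Lemma agree_offP (i : 'I_n) (x z : prod_space X) :
  agree_off i x z <-> forall k, k != i -> x k = z k.
Proof.
split=> [xz k ki|xz].
  have h : k \in (~: [set i])%SET by rewrite !inE.
  exact: (congr1 (fun g => g (exist _ k h)) xz).
apply: functional_extensionality_dep => -[k h].
by apply: xz => /=; move: (h); rewrite !inE.
Qed.

Variable f : prod_space X -> R.
Hypothesis lipf : hamming_lipschitz f.

Let delta i := osc_vector (trivial_metric R) f i ord0.

Let local_osc_fin i : (0 <= local_osc (trivial_metric R) i f < +oo)%E.
Proof.
have [L fL] := lipf.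
apply/andP; split.
  apply: ereal_sup_ubound; exists point, point; split => //.
  by rewrite subrr normr0 mul0r.
apply: (@le_lt_trans _ _ `|L|%:E); last exact: ltry.
apply: ge_ereal_sup => _ [x [z [/agree_offP xz ->]]]; rewrite lee_fin.
rewrite /trivial_metric; have [xzi|xzi] := eqVneq (x i) (z i).
  by rewrite invr0 mulr0.
rewrite invr1 mulr1; apply: le_trans (fL x z) _.
rewrite /hamming (bigD1 i)//= big1 ?addr0.
  by rewrite /trivial_metric xzi mulr1 ler_norm.
by move=> k /xz ->; rewrite /trivial_metric eqxx.
Qed.

Lemma osc_vector_ge0 i : 0 <= delta i.
Proof. by rewrite /delta mxE fine_ge0//; have /andP[] := local_osc_fin i. Qed.

Lemma osc_vector_coord_osc : coord_osc_le f delta.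
Proof.
move=> i x z xz; have [xzi|xzi] := eqVneq (x i) (z i).
  rewrite (_ : x = z) ?lerDl ?osc_vector_ge0//.
  apply: functional_extensionality_dep => k.
  by have [->//|/xz] := eqVneq k i.
rewrite -lerBlDl /delta mxE -lee_fin fineK; last first.
  by have /andP[l0 ly] := local_osc_fin i; rewrite ge0_fin_numE.
apply: (@le_trans _ _ `|f x - f z|%:E); first by rewrite lee_fin ler_norm.
apply: ereal_sup_ubound; exists x, z; split; first exact/agree_offP.
by rewrite /trivial_metric xzi invr1 mulr1.
Qed.

End LocalOscillation.

(** An entry of [Gamma] is a match whose branch depends on the proof of [(i < j)%N] found inside;
    irrelevance replaces it by a given proof. *)
Lemma match_reflectT (P : Prop) (b : bool) (r : reflect P b) (T : Type)
    (F : P -> T) (G : ~ P -> T) (h : P) : (forall h1 h2 : P, h1 = h2) ->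
  match r with ReflectT h => F h | ReflectF h => G h end = F h.
Proof. by move=> irr; case: r => // h'; rewrite (irr h' h). Qed.

Lemma match_reflectF (P : Prop) (b : bool) (r : reflect P b) (T : Type)
    (F : P -> T) (y : T) : ~ P ->
  match r with ReflectT h => F h | ReflectF _ => y end = y.
Proof. by case: r. Qed.

Section GammaBound.
Context (R : realType) (n : nat) (X : 'I_n -> ptopologicalType).
Variable K : cond_laws R X.

Lemma Gamma_diag i : Gamma K i i = 1.
Proof. by rewrite mxE match_reflectF ?ltnn// eqxx. Qed.

Lemma Gamma_lower (i j : 'I_n) : (j < i)%N -> Gamma K i j = 0.
Proof.
move=> ji; rewrite mxE match_reflectF; last by apply/negP; rewrite -leqNgt ltnW.
by case: eqP ji => // ->; rewrite ltnn.
Qed.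

(** The entry is [fine] of a supremum, which bounds the difference once the supremum is known to be
    finite; it lies between 0 and 1. *)
Lemma Gamma_tv (i j : 'I_n) (ij : (i < j)%N) (x z : prod_space X)
    (B : set (sub_space X (from j))) : agree_off i x z -> measurable B ->
  fine (K i (restr (upto i) x) (sub_restr (from_sub_after ij) @^-1` B)) <=
  fine (K i (restr (upto i) z) (sub_restr (from_sub_after ij) @^-1` B)) +
  Gamma K i j.
Proof.
move=> xz mB; rewrite mxE (match_reflectT _ _ _ ij); last first.
  by move=> h1 h2; exact: bool_irrelevance.
rewrite -lerBlDl.
set S := ereal_sup _.
have mr : measurable_fun setT (sub_restr (from_sub_after ij) :
    sub_space X (after i) -> sub_space X (from j)).
  apply: measurable_fun_prod_space => k C bC.
  exact: (@measurable_coord_preimage _ (fun j : {j | j \in after i} => X (val j))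
    (exist _ (val k) _)).
have mrB C : measurable C -> measurable (sub_restr (from_sub_after ij) @^-1` C :
    set (sub_space X (after i))).
  by move=> mC; rewrite -[X in measurable X]setTI; exact: mr.
have Kfin u C : measurable C ->
    K i u (sub_restr (from_sub_after ij) @^-1` C) \is a fin_num.
  by move=> mC; apply: (fin_num_measure (pker_prob (K i) u)); exact: mrB.
have K1 u C : measurable C ->
    (K i u (sub_restr (from_sub_after ij) @^-1` C) <= 1)%E.
  by move=> mC; apply: (probability_le1 (pker_prob (K i) u)); exact: mrB.
have K0 u C : (0 <= K i u (sub_restr (from_sub_after ij) @^-1` C))%E by [].
have S1 : (S <= 1)%E.
  apply: ge_ereal_sup => _ [x' [z' [_ ->]]].
  apply: ge_ereal_sup => _ [C mC <-]; rewrite /cond_marginal /pushforward.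
  have := Kfin (restr (upto i) x') _ mC; have := Kfin (restr (upto i) z') _ mC.
  have := K1 (restr (upto i) x') _ mC; have := K1 (restr (upto i) z') _ mC.
  have := K0 (restr (upto i) x') C; have := K0 (restr (upto i) z') C.
  case: (K i _ _) => // a; case: (K i _ _) => // b; rewrite !lee_fin => *.
  by rewrite ler_norml; apply/andP; split; lra.
have le_S : (`|K i (restr (upto i) x) (sub_restr (from_sub_after ij) @^-1` B) -
    K i (restr (upto i) z) (sub_restr (from_sub_after ij) @^-1` B)| <= S)%E.
  apply: (@le_trans _ _ (tv_dist (cond_marginal K ij (restr (upto i) x))
                      (cond_marginal K ij (restr (upto i) z)))).
    by apply: ereal_sup_ubound; exists B.
  by apply: ereal_sup_ubound; exists x, z.
have Sfin : S \is a fin_num.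
  rewrite ge0_fin_numE; first by apply: le_lt_trans S1 _; exact: ltry.
  by apply: le_trans le_S; exact: abse_ge0.
rewrite -lee_fin (fineK Sfin); apply: le_trans le_S.
rewrite EFinB !fineK//; [exact: lee_abs|exact: Kfin|exact: Kfin].
Qed.

End GammaBound.

Section Extend.
Context (n : nat) (X : 'I_n -> ptopologicalType) (I : {set 'I_n}).

(** Turns a tail event of the full space into an event on the block from [j] on: a tail set is
    insensitive to the filler [point]. *)
Definition extend (u : sub_space X I) : prod_space X :=
  fun k => match boolP (k \in I) with
           | AltTrue h => u (exist _ k h)
           | AltFalse _ => point
           end.

Lemma extendE u (k : 'I_n) (h : k \in I) : extend u k = u (exist _ k h).
Proof.
rewrite /extend; case: {-}_ / boolP => h'; last by exfalso; move: h'; rewrite h.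
by rewrite (bool_irrelevance h h').
Qed.

Lemma measurable_extend : measurable_fun setT extend.
Proof.
apply: measurable_fun_prod_space => k B bB.
have [h|h] := boolP (k \in I).
  rewrite [X in measurable X](_ : _ = [set u : sub_space X I | B (u (exist _ k h))]).
    exact: (@measurable_coord_preimage _ (fun j : {j | j \in I} => X (val j))
      (exist _ k h)).
  by apply/seteqP; split => u /=; rewrite (extendE _ h).
rewrite [X in measurable X](_ : _ = [set u : sub_space X I | B point]).
  have [Bp|Bp] := pselect (B point).
    by rewrite (_ : mkset _ = setT)//; apply/seteqP; split.
  by rewrite (_ : mkset _ = set0)//; apply/seteqP; split.
apply/seteqP; split => u /=; rewrite /extend; case: {-}_ / boolP => h' //;
  by exfalso; move: h; rewrite h'.
Qed.

End Extend.

(** * Oscillation of the conditional expectations *)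

Section CondExpTheory.
Context (R : realType) (n : nat) (X : 'I_n -> ptopologicalType).
Variables (K : cond_laws R X) (i : 'I_n).
Implicit Types (phi : prod_space X -> R) (x : prod_space X).

Let U := restr (upto i) : prod_space X -> sub_space X (upto i).

Lemma splice_restr_upto x v (k : 'I_n) : (k <= i)%N -> splice (U x) v k = x k.
Proof.
move=> ki; have h : k \in upto i by rewrite inE.
by rewrite (splice_upto _ _ h).
Qed.

Lemma splice_after_eq (u u' : sub_space X (upto i)) v (k : 'I_n) :
  (i < k)%N -> splice u v k = splice u' v k.
Proof.
move=> ki; have h : k \in after i by rewrite inE.
by rewrite !(splice_after _ _ h).
Qed.

Lemma bounded_mfun_splice phi (u : sub_space X (upto i)) : bounded_mfun phi ->
  bounded_mfun (fun v => phi (splice u v)).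
Proof.
move=> [mphi [M phiM]]; split; last by exists M.
by apply: measurableT_comp => //; exact: measurable_splicer.
Qed.

Lemma cond_expE phi x : bounded_mfun phi ->
  cond_exp K i phi x = \int[pker_prob (K i) (U x)]_v phi (splice (U x) v).
Proof.
move=> bphi; rewrite /cond_exp /Rintegral; congr fine.
rewrite /splice_law integral_distribution//.
  by apply/measurable_EFinP; exact: bphi.1.
apply: (@bounded_mfun_integrable _ _ _ _ (fun v => phi (splice (U x) v))).
exact: bounded_mfun_splice.
Qed.

Lemma restr_upto_eq x z : (forall k : 'I_n, (k <= i)%N -> x k = z k) -> U x = U z.
Proof.
move=> xz; apply: functional_extensionality_dep => -[k h].
by apply: xz => /=; move: (h); rewrite inE.
Qed.

Definition adapted (W : prod_space X -> R) :=
  forall x z, (forall k : 'I_n, (k <= i)%N -> x k = z k) -> W x = W z.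

Lemma cond_exp_adapted phi : adapted (cond_exp K i phi).
Proof. by move=> x z /restr_upto_eq xz; rewrite /cond_exp /splice_law -/U xz. Qed.

Lemma cond_exp_pullout W phi x : bounded_mfun W -> bounded_mfun phi -> adapted W ->
  cond_exp K i (fun y => W y * phi y) x = W x * cond_exp K i phi x.
Proof.
move=> bW bphi aW; rewrite !cond_expE//; last exact: bounded_mfunM.
rewrite -bmf_RintegralZl; last exact: bounded_mfun_splice.
apply: eq_Rintegral => v _; congr (_ * _); apply: aW => k; exact: splice_restr_upto.
Qed.

Lemma cond_exp_last phi x : bounded_mfun phi -> i.+1 = n -> cond_exp K i phi x = phi x.
Proof.
move=> bphi ni; rewrite cond_expE// -[RHS](bmf_Rintegral_cst (pker_prob (K i) (U x))).
apply: eq_Rintegral => v _; congr phi; apply: functional_extensionality_dep => k.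
by apply: splice_restr_upto; rewrite -ltnS ni.
Qed.

Hypothesis polishX : forall i, polish R (X i).
Variables (f : prod_space X -> R) (b : 'I_n -> R).
Hypotheses (mf : measurable_fun setT f) (b_ge0 : forall j, 0 <= b j).
Hypothesis osc_f : coord_osc_le f b.

Let bf : bounded_mfun f. Proof. exact: coord_osc_bounded osc_f mf. Qed.

Let c := \sum_j Gamma K i j * b j.

(** Changing coordinate [i] acts twice: on [f] itself, at cost [b i], the diagonal term, and on the
    law of the future, at the cost given by [tail_discrepancy] with the row of [Gamma]. *)
Lemma cond_exp_osc x z : agree_off i x z ->
  cond_exp K i f x <= cond_exp K i f z + c.
Proof.
move=> xz; have xzP := (agree_offP i x z).1 xz.
pose f' y := f (splice (U z) (restr (after i) y)).
have bf' : bounded_mfun f'.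
  apply: (@coord_osc_bounded _ _ _ _ b).
    move=> j y y' yy'; apply: osc_f => k kj; rewrite /splice.
    by case: {-}_ / boolP => // h; rewrite /restr /=; exact: yy'.
  apply: measurableT_comp mf _; apply: measurableT_comp (measurable_splicer _) _.
  exact: measurable_restr.
(* The past being frozen at [z], [f'] ignores the coordinates up to [i]: they get oscillation 0,
   together with the trivial discrepancy 1. *)
pose b' (j : 'I_n) := if (i < j)%N then b j else 0.
pose tau (j : 'I_n) := if (i < j)%N then Gamma K i j else 1.
have osc_f' : coord_osc_le f' b'.
  move=> j y y' yy'; rewrite /b'; case: ifPn => ij.
    apply: osc_f => k kj; rewrite /splice.
    by case: {-}_ / boolP => // h; rewrite /restr /=; exact: yy'.
  rewrite addr0 /f' (_ : restr (after i) y = restr (after i) y')//.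
  apply: functional_extensionality_dep => -[k h]; apply: yy' => /=.
  by apply: contraNneq ij => <- /=; move: (h); rewrite inE.
have step1 : cond_exp K i f x <= \int[splice_law K i x]_y f' y + b i.
  rewrite cond_expE// -/(cond_exp K i f' x) cond_expE//.
  rewrite -(bmf_Rintegral_cst (pker_prob (K i) (U x)) (b i)).
  rewrite -bmf_RintegralD; [|exact: bounded_mfun_splice|exact: bounded_mfun_cst].
  apply: bmf_le_Rintegral; first exact: bounded_mfun_splice.
    by apply: bounded_mfunD; [exact: bounded_mfun_splice|exact: bounded_mfun_cst].
  move=> v; apply: osc_f => k ki; rewrite restr_after_splice.
  have [le_ki|lt_ik] := leqP k i; last exact: splice_after_eq.
  by rewrite !splice_restr_upto// xzP.
have step2 : \int[splice_law K i x]_y f' y <=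
    \int[splice_law K i z]_y f' y + \sum_j b' j * tau j.
  apply: tail_discrepancy => //; first exact: bf'.1.
    by move=> j; rewrite /b'; case: ifP.
  move=> j A mA tA; rewrite /tau; case: ifPn => ij; last first.
    have h1 : fine (splice_law K i x A) <= 1.
      by rewrite -lee_fin fineK ?fin_num_measure//; exact: probability_le1.
    have h0 : 0 <= fine (splice_law K i z A) by exact: fine_ge0.
    by move: h0 h1; lra.
  pose B := [set w : sub_space X (from j) | A (extend w)].
  have mB : measurable B.
    by rewrite -[X in measurable X]setTI; exact: measurable_extend.
  have AE y : splice_law K i y A =
      K i (U y) (sub_restr (from_sub_after ij) @^-1` B).
    congr (K i (U y) _); apply/seteqP; split => v /=; apply: tA => k jk.
      have h : k \in from j by rewrite inE.
      by rewrite (extendE _ h); exact: splice_after.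
    have h : k \in from j by rewrite inE.
    by rewrite (extendE _ h); apply/esym; exact: splice_after.
  by rewrite !AE; exact: Gamma_tv.
have step3 : \int[splice_law K i z]_y f' y = cond_exp K i f z.
  rewrite -/(cond_exp K i f' z) !cond_expE//; apply: eq_Rintegral => v _.
  by rewrite /f' restr_after_splice.
have -> : c = \sum_j b' j * tau j + b i.
  rewrite /c (bigD1 i)//= [in RHS](bigD1 i)//= Gamma_diag mul1r.
  rewrite /b' {2}/tau ltnn mul0r add0r addrC; congr (_ + _).
  apply: eq_bigr => j ji; rewrite /tau; case: ifPn => ij; first by rewrite mulrC.
  rewrite mul0r Gamma_lower ?mul0r// ltn_neqAle leqNgt ij andbT.
  by rewrite -val_eqE in ji.
by move: step1 step2; rewrite step3; lra.
Qed.

(** The point [y] differs from [x] at most at [i] and agrees with [z] up to [i], hence has the same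
    conditional expectation as [z]. *)
Lemma cond_exp_osc_strict x z : (forall k : 'I_n, (k < i)%N -> x k = z k) ->
  cond_exp K i f x <= cond_exp K i f z + c.
Proof.
move=> xz; pose y : prod_space X := fun k => if k == i then z k else x k.
have xy : agree_off i x y by apply/agree_offP => k; rewrite /y => /negbTE ->.
rewrite (@cond_exp_adapted f z y); first exact: cond_exp_osc.
move=> k; rewrite /y leq_eqVlt => /predU1P[/val_inj ->|ki]; first by rewrite eqxx.
by case: eqP => // _; rewrite xz.
Qed.

End CondExpTheory.

(** * Exponential moments and tails *)

Lemma ae_eq_Rintegral (R : realType) d (T : measurableType d)
    (P : probability T R) (g h : T -> R) :
  measurable_fun setT g -> measurable_fun setT h ->
  {ae P, forall x, g x = h x} -> \int[P]_x g x = \int[P]_x h x.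
Proof.
move=> /measurable_EFinP mg /measurable_EFinP mh gh.
have gh' : ae_eq P setT (EFin \o g) (EFin \o h).
  by apply: filterS gh => x gx _ /=; rewrite gx.
have := @ae_eq_integral _ _ _ P _ _ _ measurableT mg mh gh'.
by rewrite /Rintegral => /= ->.
Qed.

Section MartingaleMgf.
Context (R : realType) (n : nat) (X : 'I_n -> ptopologicalType).
Hypothesis polishX : forall i, polish R (X i).
Variables (mu : probability (prod_space X) R) (K : cond_laws R X).
Hypothesis condK : is_cond_laws mu K.
Variables (f : prod_space X -> R) (b : 'I_n -> R).
Hypotheses (mf : measurable_fun setT f) (b_ge0 : forall j, 0 <= b j).
Hypothesis osc_f : coord_osc_le f b.

Let bf : bounded_mfun f. Proof. exact: coord_osc_bounded osc_f mf. Qed.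

Let F i := cond_exp K i f.

Let bF i : bounded_mfun (F i). Proof. exact: bounded_mfun_cond_exp. Qed.

(* Both sides integrate like [f] against every bounded function of the coordinates
   up to [i], in particular against their difference. *)
Lemma cond_exp_tower (i j : 'I_n) : (i <= j)%N ->
  {ae mu, forall x, cond_exp K i (F j) x = F i x}.
Proof.
move=> ij; pose W x := cond_exp K i (F j) x - F i x.
have bc : bounded_mfun (cond_exp K i (F j)) by exact: bounded_mfun_cond_exp.
have bW : bounded_mfun W by exact: bounded_mfunB.
have aW : adapted i W.
  by move=> x z xz; rewrite /W /F !(@cond_exp_adapted _ _ _ _ _ _ x z).
have aWj : adapted j W.
  by move=> x z xz; apply: aW => k ki; apply: xz; exact: leq_trans ki ij.
have E1 : \int[mu]_x (W x * cond_exp K i (F j) x) = \int[mu]_x (W x * f x).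
  transitivity (\int[mu]_x (W x * F j x)).
    rewrite -[RHS](Rintegral_cond_exp i condK); last exact: bounded_mfunM.
    by apply: eq_Rintegral => x _; rewrite cond_exp_pullout.
  rewrite -[RHS](Rintegral_cond_exp j condK); last exact: bounded_mfunM.
  by apply: eq_Rintegral => x _; rewrite cond_exp_pullout.
have E2 : \int[mu]_x (W x * F i x) = \int[mu]_x (W x * f x).
  rewrite -[RHS](Rintegral_cond_exp i condK); last exact: bounded_mfunM.
  by apply: eq_Rintegral => x _; rewrite cond_exp_pullout.
have bWW : bounded_mfun (fun x => W x * W x) by exact: bounded_mfunM.
have W0 : \int[mu]_x (W x * W x) = 0.
  rewrite (@eq_Rintegral _ _ _ mu setT
    (fun x => W x * cond_exp K i (F j) x - W x * F i x)); last first.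
    by move=> x _; rewrite {2}/W mulrBr.
  rewrite (bmf_RintegralB mu (bounded_mfunM bW bc) (bounded_mfunM bW (bF i))).
  by rewrite E1 E2 subrr.
have : ae_eq mu setT (EFin \o (fun x => W x * W x)) (cst 0%E).
  apply/ae_eq_integral_abs => //; first by apply/measurable_EFinP; exact: bWW.1.
  rewrite (eq_integral (EFin \o (fun x => W x * W x))); last first.
    by move=> x _ /=; rewrite ger0_norm// -expr2 sqr_ge0.
  rewrite -[LHS]fineK; first by rewrite -[fine _]/(\int[mu]_x (W x * W x)) W0.
  by apply: integrable_fin_num => //; exact: bounded_mfun_integrable.
by apply: filterS => x /= /(_ I) [] /eqP; rewrite mulf_eq0 orbb subr_eq0 => /eqP.
Qed.

Let c i := \sum_j Gamma K i j * b j.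

(** Induction on [i]. Under the kernel of the previous index, [F i] has oscillation [c i] and,
    almost everywhere, mean [F j], so Hoeffding's lemma contributes one factor. *)
Lemma cond_exp_mgf (s : R) (i : 'I_n) :
  \int[mu]_x expR (s * F i x) <=
  expR (s * \int[mu]_x f x + s ^+ 2 / 8 * \sum_(k < n | (k <= i)%N) c k ^+ 2).
Proof.
have bs (g : prod_space X -> R) : bounded_mfun g -> bounded_mfun (fun x => expR (s * g x)).
  move=> bg; apply: bounded_mfun_expR; apply: bounded_mfunM => //.
  exact: bounded_mfun_cst.
have [m] := ubnP (i : nat); elim: m i => // m IHm i im.
(* At the first index no coordinate precedes [i], so [F i] oscillates by at most [c i] on the whole
   space and Hoeffding's lemma applies to [mu] itself. *)
have [i0|i0] := posnP i.
  have Fosc x y : F i x <= F i y + c i.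
    by apply: cond_exp_osc_strict => // k; rewrite i0.
  apply: le_trans (hoeffding_mgf mu s (bF i) Fosc) _.
  rewrite ler_expR Rintegral_cond_exp// (big_pred1 i) => [|k]; last first.
    by rewrite /= -val_eqE /= i0 leqn0.
  by rewrite mulrAC.
have hj : (i.-1 < n)%N by apply: leq_ltn_trans (leq_pred _) (ltn_ord i).
pose j := Ordinal hj.
have ji : (j <= i)%N by exact: leq_pred.
have /IHm IHj : (j < m)%N by rewrite /= prednK.
have step : \int[mu]_x expR (s * F i x) <=
    \int[mu]_x (expR (s ^+ 2 * c i ^+ 2 / 8) * expR (s * F j x)).
  rewrite -(Rintegral_cond_exp j condK (bs _ (bF i))).
  have bc : bounded_mfun (cond_exp K j (F i)) by exact: bounded_mfun_cond_exp.
  apply: (@le_trans _ _ (\int[mu]_x (expR (s ^+ 2 * c i ^+ 2 / 8) *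
      expR (s * cond_exp K j (F i) x)))).
    apply: bmf_le_Rintegral; first by apply: bounded_mfun_cond_exp; exact: bs.
      by apply: bounded_mfunM; [exact: bounded_mfun_cst|exact: bs].
    move=> x; rewrite -expRD addrC cond_expE; last exact: bs.
    rewrite [cond_exp _ _ _ x]cond_expE//; apply: hoeffding_mgf.
      exact: bounded_mfun_splice.
    move=> v w; apply: cond_exp_osc_strict => // k ki.
    by rewrite !splice_restr_upto// -ltnS prednK.
  rewrite (@ae_eq_Rintegral _ _ _ _ _ (fun x => expR (s ^+ 2 * c i ^+ 2 / 8) *
      expR (s * F j x)))//.
  - by apply: (bounded_mfunM (bounded_mfun_cst _ _) (bs _ bc)).1.
  - by apply: (bounded_mfunM (bounded_mfun_cst _ _) (bs _ (bF j))).1.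
  - by apply: filterS (cond_exp_tower ji) => x ->.
apply: le_trans step _; rewrite bmf_RintegralZl; last exact: bs.
apply: le_trans (ler_wpM2l (expR_ge0 _) IHj) _.
rewrite -expRD ler_expR [in leRHS](bigD1 i)//=.
have -> : \sum_(k < n | (k <= i)%N && (k != i)) c k ^+ 2 =
    \sum_(k < n | (k <= j)%N) c k ^+ 2.
  apply: eq_bigl => k.
  by rewrite -val_eqE /= andbC -ltn_neqAle -[RHS]ltnS prednK.
by rewrite le_eqVlt; apply/orP; left; apply/eqP; ring.
Qed.

Lemma lipschitz_mgf (s : R) :
  \int[mu]_x expR (s * f x) <=
  expR (s * \int[mu]_x f x + s ^+ 2 / 8 * \sum_i c i ^+ 2).
Proof.
(* For [n = 0] the space is a single point and [f] is constant; otherwise the last conditional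
   expectation is [f]. *)
case: (posnP n) => [n0|n0].
  have fE x : f x = f point.
    congr f; apply: functional_extensionality_dep => k.
    by have := ltn_ord k; rewrite {2}n0.
  have -> : \int[mu]_x f x = f point.
    by rewrite -(bmf_Rintegral_cst mu (f point)); apply: eq_Rintegral => x _.
  rewrite (@eq_Rintegral _ _ _ mu setT (fun=> expR (s * f point))) => [|x _];
    last by rewrite fE.
  rewrite bmf_Rintegral_cst ler_expR lerDl mulr_ge0// ?divr_ge0// ?sqr_ge0//.
  by apply: sumr_ge0 => k _; exact: sqr_ge0.
have hl : (n.-1 < n)%N by rewrite prednK.
have := cond_exp_mgf s (Ordinal hl).
have -> : \sum_(k < n | (k <= Ordinal hl)%N) c k ^+ 2 = \sum_i c i ^+ 2.
  by apply: eq_bigl => k; rewrite /= -ltnS prednK// ltn_ord.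
rewrite (@eq_Rintegral _ _ _ mu setT (fun x => expR (s * f x)))// => x _.
by rewrite /F cond_exp_last//= prednK.
Qed.

End MartingaleMgf.

Lemma chernoff_bound (R : realType) d (T : measurableType d) (P : probability T R)
    (g : T -> R) (s a : R) : bounded_mfun g -> 0 <= s ->
  fine (P [set x | a <= g x]) <= expR (- (s * a)) * \int[P]_x expR (s * g x).
Proof.
move=> bg s0.
have mA : measurable [set x | a <= g x].
  rewrite -[X in measurable X]setTI.
  exact: (measurable_fun_le measurableT (measurable_cst _) bg.1).
have bs : bounded_mfun (fun x => expR (s * g x)).
  by apply: bounded_mfun_expR; apply: bounded_mfunM => //; exact: bounded_mfun_cst.
rewrite -Rintegral_indic// -bmf_RintegralZl//; apply: bmf_le_Rintegral.
- exact: bounded_mfun_indic.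
- by apply: bounded_mfunM => //; exact: bounded_mfun_cst.
move=> x; rewrite indicE; have [/set_mem /= ax|_] := boolP (x \in _).
  by rewrite -expRD -expR0 ler_expR addrC subr_ge0 ler_wpM2l.
by rewrite mulr_ge0 ?expR_ge0.
Qed.

(** The moment bound holds for both signs of [r], so Chernoff's bound applies to the centred
    function and to its opposite; the union bound gives the factor 2. *)
Lemma two_sided_chernoff (R : realType) d (T : measurableType d)
    (P : probability T R) (g : T -> R) (C t s : R) : bounded_mfun g -> 0 <= s ->
  (forall r, \int[P]_x expR (r * g x) <= expR (r * \int[P]_x g x + r ^+ 2 / 8 * C)) ->
  fine (P [set x | t <= `|g x - \int[P]_x g x|]) <=
  2 * expR (- (s * t) + s ^+ 2 / 8 * C).
Proof.
move=> bg s0 mgf; set m := \int[P]_x g x.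
pose g1 x := g x - m; pose g2 x := - g1 x.
have bg1 : bounded_mfun g1 by apply: bounded_mfunB => //; exact: bounded_mfun_cst.
have bg2 : bounded_mfun g2 by exact: bounded_mfunN.
have be (r : R) : bounded_mfun (fun x => expR (r * g x)).
  by apply: bounded_mfun_expR; apply: bounded_mfunM => //; exact: bounded_mfun_cst.
have mge (h : T -> R) : bounded_mfun h -> measurable [set x | t <= h x].
  move=> bh; rewrite -[X in measurable X]setTI.
  exact: (measurable_fun_le measurableT (measurable_cst _) bh.1).
have shift (r : R) : \int[P]_x expR (r * g1 x) <= expR (r ^+ 2 / 8 * C).
  rewrite (@eq_Rintegral _ _ _ P setT (fun x => expR (- (r * m)) * expR (r * g x))).
    rewrite bmf_RintegralZl//; apply: le_trans (ler_wpM2l (expR_ge0 _) (mgf r)) _.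
    by rewrite -expRD addrA addNr add0r.
  by move=> x _; rewrite -expRD; congr expR; rewrite /g1; ring.
have tail1 : fine (P [set x | t <= g1 x]) <= expR (- (s * t) + s ^+ 2 / 8 * C).
  by apply: le_trans (chernoff_bound P t bg1 s0) _; rewrite expRD ler_wpM2l ?expR_ge0.
have tail2 : fine (P [set x | t <= g2 x]) <= expR (- (s * t) + s ^+ 2 / 8 * C).
  apply: le_trans (chernoff_bound P t bg2 s0) _; rewrite expRD ler_wpM2l ?expR_ge0//.
  rewrite (@eq_Rintegral _ _ _ P setT (fun x => expR (- s * g1 x))).
    by apply: le_trans (shift (- s)) _; rewrite sqrrN.
  by move=> x _; rewrite /g2 mulrN mulNr.
have PA : (P [set x | (t <= `|g x - m|)%R] <=
    P [set x | (t <= g1 x)%R] + P [set x | (t <= g2 x)%R])%E.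
  rewrite (_ : [set x | t <= `|g x - m|] = [set x | t <= g1 x] `|` [set x | t <= g2 x]).
    by apply: measureU2; exact: mge.
  by apply/seteqP; split => x /=; rewrite ler_normr; [move/orP|move=> ?; exact/orP].
have := fin_num_measure P _ (mge _ bg1); have := fin_num_measure P _ (mge _ bg2).
have PAfin : P [set x | (t <= `|g x - m|)%R] \is a fin_num.
  apply: fin_num_measure; apply: (mge (fun x => `|g x - m|)); split.
    by apply: measurableT_comp => //; exact: bg1.1.
  by have [_ [M gM]] := bg1; exists M => x; rewrite normr_id; exact: gM.
move=> f2 f1; move: PA; rewrite -(fineK f1) -(fineK f2) -(fineK PAfin) -EFinD lee_fin.
by move=> PA; move: PA tail1 tail2; lra.
Qed.

(* The exponent [-st + s^2 C / 8] is minimal at [s = 4t/C]; for [C = 0] it tends to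
   [-oo] with [s] as soon as [t > 0]. *)
Lemma subgaussian_tail (R : realType) d (T : measurableType d)
    (P : probability T R) (g : T -> R) (C t : R) : bounded_mfun g -> 0 <= C -> 0 <= t ->
  (forall r, \int[P]_x expR (r * g x) <= expR (r * \int[P]_x g x + r ^+ 2 / 8 * C)) ->
  (P [set x | (t <= `|g x - \int[P]_x g x|)%R] <=
    2%:E * expeR (- ((2 * t ^+ 2)%:E / C%:E)))%E.
Proof.
move=> bg C0 t0 mgf; set A := [set x | _].
have mA : measurable A.
  rewrite /A -[X in measurable X]setTI.
  apply: (measurable_fun_le measurableT (measurable_cst _)).
  apply: measurableT_comp => //.
  exact: (bounded_mfunB bg (bounded_mfun_cst _ _)).1.
have PAfin := fin_num_measure P A mA.
have H s : 0 <= s -> fine (P A) <= 2 * expR (- (s * t) + s ^+ 2 / 8 * C).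
  by move=> s0; exact: two_sided_chernoff.
(* In the extended reals the inverse of 0 is [+oo], which makes [C = 0] a separate case. *)
rewrite inver; case: ifPn => [/eqP C00|Cn0]; last first.
  have Cp : 0 < C by rewrite lt_def Cn0.
  rewrite -EFinM /= -(fineK PAfin) lee_fin.
  have /H : 0 <= 4 * t / C by rewrite divr_ge0// mulr_ge0.
  rewrite (_ : - (_ * t) + _ = - (2 * t ^+ 2 / C))//.
  by field.
move: t0; rewrite le_eqVlt => /orP[/eqP t00|tp].
  (* At [t = 0] the convention that 0 times [+oo] is 0 makes the bound equal to 2. *)
  rewrite -t00 expr0n/= mulr0 mul0e oppe0 expeR0 mule1.
  apply: (@le_trans _ _ 1%E); first exact: probability_le1.
  by rewrite lee_fin ler1n.
rewrite gt0_muley ?lte_fin ?mulr_gt0 ?exprn_gt0//= mule0.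
rewrite -(fineK PAfin) lee_fin leNgt; apply/negP; set r := fine _ => r0.
(* If the probability [r] were positive, this [s] would give r exp(2/r) <= 2, while exp(2/r) >= 1 +
   2/r gives r exp(2/r) >= r + 2. *)
have s0 : 0 <= 2 / (r * t) by rewrite divr_ge0// mulr_ge0// ltW.
have := H _ s0; rewrite C00 mulr0 addr0 -/r.
have -> : 2 / (r * t) * t = 2 / r by field; rewrite !gt_eqF.
have e1 : 1 + 2 / r <= expR (2 / r) by exact: expR_ge1Dx.
rewrite expRN ler_pdivlMr ?expR_gt0//.
have := ler_wpM2l (ltW r0) e1; rewrite mulrDr mulr1 mulrCA divff ?gt_eqF//; lra.
Qed.

(* The right-hand side is computed in the extended reals: when the norm is 0, *)
(* the bound is 0 for t > 0 (and 2 for t = 0).                                *)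
Theorem mainTheorem9 (R : realType) (n : nat) (X : 'I_n -> ptopologicalType)
    (polishX : forall i, polish R (X i))
    (mu : probability (prod_space X) R)
    (K : cond_laws R X) (condK : is_cond_laws mu K)
    (f : prod_space X -> R) (mf : measurable_fun setT f)
    (lipf : hamming_lipschitz f)
    (t : R) (t_ge0 : 0 <= t) :
  (mu [set x | t%:E <= `|(f x)%:E - 'E_mu[f]|] <=
   2%:E * expeR (- ((2 * t ^+ 2)%:E /
     (l2norm (Gamma K *m osc_vector (trivial_metric R) f) ^+ 2)%:E)))%E.
Proof.
pose b i := osc_vector (trivial_metric R) f i ord0.
have osc_f : coord_osc_le f b by exact: osc_vector_coord_osc.
have b0 i : 0 <= b i by exact: osc_vector_ge0.
have bf : bounded_mfun f by exact: coord_osc_bounded osc_f mf.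
rewrite /l2norm sqr_sqrtr; last by apply: sumr_ge0 => i _; exact: sqr_ge0.
have -> : ('E_mu[f] = (\int[mu]_x f x)%R%:E)%E.
  rewrite unlock fineK//; apply: integrable_fin_num => //.
  exact: bounded_mfun_integrable.
have -> : [set x | (t%:E <= `|(f x)%:E - (\int[mu]_x f x)%:E|)%E] =
    [set x | t <= `|f x - \int[mu]_x f x|].
  by apply/seteqP; split => x /=; rewrite lee_fin.
apply: subgaussian_tail => //; first by apply: sumr_ge0 => i _; exact: sqr_ge0.
move=> s; under [X in _ + _ / _ * X]eq_bigr do rewrite mxE.
exact: (lipschitz_mgf polishX condK mf b0 osc_f).
Qed.
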